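(* Let $(\boldsymbol w_h,\boldsymbol u_h,\widehat{\boldsymbol u}_h)\in\boldsymbol W_h\times\boldsymbol V_h\times\boldsymbol M_h$ be the solution of the (three-dimensional) HDG method written out in the context. Then the postprocessed approximation $\boldsymbol u_h^\star$ is well-defined: for every $T\in\mathcal T_h$ there is exactly one $\boldsymbol u_h^\star\in\boldsymbol{\mathcal P}_{k+1}(T)$ such that $$\begin{aligned}(\boldsymbol u_h^\star-\boldsymbol u_h,\nabla\times\boldsymbol r)_T+\langle\boldsymbol n\times\boldsymbol u_h^\star-\boldsymbol n\times\widehat{\boldsymbol u}_h,\boldsymbol r\rangle_{\partial T}&=0\quad\forall\,\boldsymbol r\in\nabla\times\boldsymbol{\mathcal P}_{k+1}(T),\\(\boldsymbol u_h^\star-\boldsymbol u_h,\nabla v)_T&=0\quad\forall\, v\in\mathcal P_{k+2}(T).\end{aligned}$$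
   Context: **Setting.** $\Omega\subset\mathbb R^3$ is a bounded polyhedral domain with boundary $\Gamma$ and unit outward normal $\boldsymbol n$; $\varepsilon>0$ is a constant, $\boldsymbol\beta\in\boldsymbol W^{1,\infty}(\Omega)$, $\gamma\in L^\infty(\Omega)$, $\boldsymbol f\in\boldsymbol L^2(\Omega)$, $\boldsymbol g\in\boldsymbol H^{3/2}(\Gamma)$; $\Gamma^-=\{\boldsymbol x\in\Gamma:\boldsymbol\beta\cdot\boldsymbol n<0\}$, $\Gamma^+=\{\boldsymbol x\in\Gamma:\boldsymbol\beta\cdot\boldsymbol n\ge0\}$ with indicator functions $\chi_{\Gamma^\pm}$. $\mathcal T_h$ is a conforming simplicial triangulation of $\Omega$; $\mathcal F_h$ is the set of all facets and $\mathcal F_h^\partial$ the boundary facets; $\partial\mathcal T_h$ is the collection of all $\partial T$ (interior facets counted twice). $(\cdot,\cdot)_D$ and $\langle\cdot,\cdot\rangle_D$ are $L^2$ inner products over 3D, respectively 2D, sets; $(\cdot,\cdot)_{\mathcal T_h}=\sum_T(\cdot,\cdot)_T$, $\langle\cdot,\cdot\rangle_{\partial\mathcal T_h}=\sum_T\langle\cdot,\cdot\rangle_{\partial T}$; on $\partial T$, $\boldsymbol n$ is the outward normal of $T$. For $k\ge 0$, $\mathcal P_k(D)$ and $\boldsymbol{\mathcal P}_k(D)$ are the scalar, respectively $\mathbb R^3$-valued, polynomials of degree $\le k$ on $D$; $\boldsymbol W_h=\boldsymbol V_h=\{\boldsymbol v\in \boldsymbol L^2(\Omega):\boldsymbol v|_T\in\boldsymbol{\mathcal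 P}_k(T)\ \forall T\}$, $\boldsymbol M_h=\{\boldsymbol\mu\in\boldsymbol L^2(\mathcal F_h):\boldsymbol\mu|_F\in\boldsymbol{\mathcal P}_k(F)\ \forall F\}$. **HDG method.** With $\mathcal L_{\boldsymbol\beta}\boldsymbol v=\nabla\times(\boldsymbol\beta\times\boldsymbol v)-\boldsymbol\beta\,\nabla\cdot\boldsymbol v$ and nonnegative stabilization parameters $\tau_t,\tau_n$, constant on each facet of each element, find $(\boldsymbol w_h,\boldsymbol u_h,\widehat{\boldsymbol u}_h)\in\boldsymbol W_h\times\boldsymbol V_h\times\boldsymbol M_h$ such that for all $(\boldsymbol r,\boldsymbol v,\boldsymbol\mu)\in\boldsymbol W_h\times\boldsymbol V_h\times\boldsymbol M_h$: $$(\varepsilon^{-1}\boldsymbol w_h,\boldsymbol r)_{\mathcal T_h}-(\boldsymbol u_h,\nabla\times\boldsymbol r)_{\mathcal T_h}+\langle\widehat{\boldsymbol u}_h,\boldsymbol n\times\boldsymbol r\rangle_{\partial\mathcal T_h}=0,$$ $$(\boldsymbol w_h,\nabla\times\boldsymbol v)_{\mathcal T_h}+\langle\boldsymbol n\times\widehat{\boldsymbol w}_h,\boldsymbol v\rangle_{\partial\mathcal T_h}+(\boldsymbol u_h,\mathcal L_{\boldsymbol\beta}\boldsymbol v+\gamma\boldsymbol v)_{\mathcal T_h}+\langle\boldsymbol n\times\widehat{\boldsymbol u}_h,\boldsymbol\beta\times\boldsymbol v\rangle_{\partial\mathcal T_h}+\langle\widehat{\boldsymbol\beta\cdot\boldsymbol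 u_h},\boldsymbol n\cdot\boldsymbol v\rangle_{\partial\mathcal T_h}=(\boldsymbol f,\boldsymbol v)_{\mathcal T_h},$$ $$-\langle\boldsymbol n\times\widehat{\boldsymbol w}_h-\boldsymbol\beta\times(\boldsymbol n\times\widehat{\boldsymbol u}_h)+\widehat{\boldsymbol\beta\cdot\boldsymbol u_h}\,\boldsymbol n,\boldsymbol\mu\rangle_{\partial\mathcal T_h\setminus\mathcal F_h^\partial}=0,$$ $$\langle\boldsymbol n\times\widehat{\boldsymbol u}_h+\chi_{\Gamma^-}(\widehat{\boldsymbol u}_h\cdot\boldsymbol n)\boldsymbol n-\chi_{\Gamma^+}\tau_n[(\boldsymbol u_h-\widehat{\boldsymbol u}_h)\cdot\boldsymbol n]\boldsymbol n,\boldsymbol\mu\rangle_{\mathcal F_h^\partial}=\langle\boldsymbol g,\boldsymbol\mu\rangle_{\mathcal F_h^\partial},$$ where $\widehat{\boldsymbol w}_h=\boldsymbol w_h+\tau_t(\boldsymbol u_h-\widehat{\boldsymbol u}_h)\times\boldsymbol n$ and $\widehat{\boldsymbol\beta\cdot\boldsymbol u_h}=\boldsymbol\beta\cdot\widehat{\boldsymbol u}_h+\tau_n(\boldsymbol u_h-\widehat{\boldsymbol u}_h)\cdot\boldsymbol n$ on $\partial\mathcal T_h$. *)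

(* Defs.v *)
From HB Require Import structures.
From mathcomp Require Import all_boot all_order all_algebra.
From mathcomp Require Import all_classical all_reals all_analysis.
(* The notations of mpoly clash with those of mathcomp-analysis. *)
From mathcomp Require mpoly.
Import (canonicals, coercions) mpoly.
Set Implicit Arguments.
Unset Strict Implicit.
Unset Printing Implicit Defensive.
Import Order.TTheory GRing.Theory Num.Theory.
Import numFieldNormedType.Exports.
Local Open Scope classical_set_scope.
Local Open Scope ring_scope.

(* Points and vectors of R^3 are row vectors.  Index arithmetic on 'I_3 is
   modulo 3, so (i, i + 1, i + 2) is a cyclic permutation of the axes. *)
Section Algebra3.
Variable R : realType.
Implicit Types a b : 'rV[R]_3.

Definition dot a b : R := \sum_i a 0 i * b 0 i.

Definition cross a b : 'rV[R]_3 :=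
  \row_i (a 0 (i + 1) * b 0 (i + 2%:R) - a 0 (i + 2%:R) * b 0 (i + 1)).

(* The canonical norm of 'rV[R]_3 is the sup norm, hence this one. *)
Definition enorm a : R := Num.sqrt (dot a a).

End Algebra3.

Section Calculus3.
Variable R : realType.
Implicit Types (phi : 'rV[R]_3 -> R) (F : 'rV[R]_3 -> 'rV[R]_3).

Definition partial (i : 'I_3) phi : 'rV[R]_3 -> R :=
  fun x => 'D_(delta_mx 0 i) phi x.

Definition coord F (i : 'I_3) : 'rV[R]_3 -> R := fun x => F x 0 i.

Definition grad phi : 'rV[R]_3 -> 'rV[R]_3 :=
  fun x => \row_i partial i phi x.

Definition div F : 'rV[R]_3 -> R := fun x => \sum_i partial i (coord F i) x.

Definition curl F : 'rV[R]_3 -> 'rV[R]_3 :=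
  fun x => \row_i (partial (i + 1) (coord F (i + 2%:R)) x
                   - partial (i + 2%:R) (coord F (i + 1)) x).

(* Polynomial functions of total degree <= k (msize is the degree plus one,
   and 0 for the zero polynomial).  Since the restriction to a nondegenerate
   tetrahedron T is injective on them, they also stand for P_k(T). *)
Definition Pk (k : nat) phi : Prop :=
  exists p : mpoly.mpoly 3 R,
    (mpoly.msize p <= k.+1)%N /\ forall x, phi x = mpoly.meval (x 0) p.

Definition Pkv (k : nat) F : Prop := forall i, Pk k (coord F i).

End Calculus3.

Section Sobolev.
Variable R : realType.
Implicit Types (D : set 'rV[R]_3) (f g phi : 'rV[R]_3 -> R).
Implicit Type F : 'rV[R]_3 -> 'rV[R]_3.

Definition leb2 := (@lebesgue_measure R \x @lebesgue_measure R)%E.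
Definition leb3 := (leb2 \x @lebesgue_measure R)%E.

(* The library has Lebesgue measure on R * R * R, but not on 'rV[R]_3. *)
Definition pt (p : R * R * R) : 'rV[R]_3 :=
  \row_i [tuple p.1.1; p.1.2; p.2]`_i.

Definition vint D f : R := \int[leb3]_(p in pt @^-1` D) f (pt p).

Definition Lp (p : \bar R) D f : Prop :=
  ((f \o pt) \_ (pt @^-1` D)) \in Lfun leb3 p.

Definition test_fun D phi : Prop :=
  (forall (s : seq 'I_3) x, differentiable (foldr (@partial R) phi s) x) /\
  (exists K : set 'rV[R]_3,
     [/\ compact K, K `<=` D & forall x, ~ K x -> phi x = 0]).

(* L^1 rather than L^1_loc: all weak derivatives below are at least in L^1,
   the domains being bounded. *)
Definition weak_partial D (i : 'I_3) f g : Prop :=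
  Lp 1%E D g /\
  forall phi, test_fun D phi ->
    vint D (fun x => f x * partial i phi x) = - vint D (fun x => g x * phi x).

Definition W1 (p : \bar R) D f : Prop :=
  Lp p D f /\ forall i, exists2 g, Lp p D g & weak_partial D i f g.

Definition H2 D f : Prop :=
  Lp 2%:E D f /\ forall i, exists2 g, W1 2%:E D g & weak_partial D i f g.

(* W^{1,oo}(D)^3, each class being represented by its continuous member, so
   that traces can be taken as limits. *)
Definition W1oov D F : Prop :=
  (forall x, D x -> {for x, continuous F}) /\
  forall i, W1 +oo%E D (coord F i).

Definition Lpv (p : \bar R) D F : Prop := forall i, Lp p D (coord F i).

(* Unique up to a null set when it exists. *)
Definition wpartial D (i : 'I_3) f : 'rV[R]_3 -> R :=
  xget (fun=> 0) [set g | weak_partial D i f g].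

Definition wcurl D F : 'rV[R]_3 -> 'rV[R]_3 :=
  fun x => \row_i (wpartial D (i + 1) (coord F (i + 2%:R)) x
                   - wpartial D (i + 2%:R) (coord F (i + 1)) x).

End Sobolev.

Section Geometry.
Variable R : realType.
Local Notation tetra := ('I_4 -> 'rV[R]_3).
Implicit Types (T : tetra) (S : {set 'I_4}) (j : 'I_4) (Omega : set 'rV[R]_3).

(* Closed and relatively open face of T with vertices (T i), i in S. *)
Definition cface T S : set 'rV[R]_3 :=
  [set x | exists l : 'I_4 -> R,
     [/\ forall i, 0 <= l i, forall i, i \notin S -> l i = 0,
         \sum_i l i = 1 & x = \sum_i l i *: T i]].

Definition oface T S : set 'rV[R]_3 :=
  [set x | exists l : 'I_4 -> R,
     [/\ forall i, i \in S -> 0 < l i, forall i, i \notin S -> l i = 0,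
         \sum_i l i = 1 & x = \sum_i l i *: T i]].

Definition ctet T := cface T finset.setT.
Definition otet T := oface T finset.setT.

(* Facet opposite to the vertex T j. *)
Definition cfacet T j := cface T (finset.setC (finset.set1 j)).
Definition ofacet T j := oface T (finset.setC (finset.set1 j)).

Definition nondegenerate T : Prop :=
  \det (\matrix_(i < 3) (T (lift ord0 i) - T ord0)) != 0.

(* Omega is not assumed to be Lipschitz; Omega = int(cl Omega) excludes cracks,
   on which there would be no outward normal. *)
Definition polyhedral_domain Omega : Prop :=
  [/\ open Omega, connected Omega, Omega !=set0, bounded_set Omega
    & Omega = (closure Omega)° /\
      exists (m : nat) (P : 'I_m -> tetra),
        (forall i, nondegenerate (P i)) /\
        closure Omega = \bigcup_i ctet (P i)].

Definition bnd Omega : set 'rV[R]_3 := closure Omega `\` Omega.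

(* Conforming: two distinct elements meet in the face (possibly empty) spanned
   by their common vertices. *)
Definition triangulation Omega N (Th : 'I_N -> tetra) : Prop :=
  [/\ forall K, nondegenerate (Th K),
      closure Omega = \bigcup_K ctet (Th K),
      forall K L, K != L -> otet (Th K) `&` otet (Th L) = set0
    & forall K L, K != L ->
        ctet (Th K) `&` ctet (Th L) =
        cface (Th K) (finset [pred i | Th K i \in codom (Th L)])].

Definition bfacet Omega T j : Prop := cfacet T j `<=` bnd Omega.

Definition fvtx T j (i : 'I_3) : 'rV[R]_3 := T (lift j i).

Definition fcross T j : 'rV[R]_3 :=
  cross (fvtx T j 1 - fvtx T j 0) (fvtx T j 2%:R - fvtx T j 0).

(* Outward: the vertex opposite to the facet is on the negative side. *)
Definition normal T j : 'rV[R]_3 :=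
  (- Num.sg (dot (fcross T j) (T j - fvtx T j 0)) / enorm (fcross T j))
    *: fcross T j.

Definition reftri : set (R * R) :=
  [set p | [/\ 0 < p.1, 0 < p.2 & p.1 + p.2 < 1]].

Definition fpar T j (p : R * R) : 'rV[R]_3 :=
  fvtx T j 0 + p.1 *: (fvtx T j 1 - fvtx T j 0)
             + p.2 *: (fvtx T j 2%:R - fvtx T j 0).

(* Surface integral over a facet, through its affine parametrization; the
   length of the cross product is the constant area element. *)
Definition fint T j (f : 'rV[R]_3 -> R) : R :=
  enorm (fcross T j) * \int[@leb2 R]_(p in reftri) f (fpar T j p).

Definition fL2 T j (f : 'rV[R]_3 -> R) : Prop :=
  ((f \o fpar T j) \_ reftri) \in Lfun (@leb2 R) 2%:E.

(* Trace from inside T. *)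
Definition tr T (F : 'rV[R]_3 -> 'rV[R]_3) : 'rV[R]_3 -> 'rV[R]_3 :=
  fun x => lim (F @ within (otet T) (nbhs x)).

(* H^{3/2}(Gamma)^3 as the space of traces of H^2(Omega)^3 (in dimension 3,
   classes in H^2 have continuous representatives); Gamma is the union of the
   boundary facets of the mesh. *)
Definition H32 Omega N (Th : 'I_N -> tetra) (g : 'rV[R]_3 -> 'rV[R]_3) : Prop :=
  exists G : 'rV[R]_3 -> 'rV[R]_3,
    [/\ forall i, H2 Omega (coord G i),
        forall x, Omega x -> {for x, continuous G}
      & forall K j, bfacet Omega (Th K) j ->
          {ae @leb2 R, forall p, reftri p ->
             G @ within (otet (Th K)) (nbhs (fpar (Th K) j p))
               --> g (fpar (Th K) j p)}].

End Geometry.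

Section HDG.
Variable R : realType.
Local Notation tetra := ('I_4 -> 'rV[R]_3).
Local Notation vfield := ('rV[R]_3 -> 'rV[R]_3).
Variables (Omega : set 'rV[R]_3) (N : nat) (Th : 'I_N -> tetra).

(* W_h = V_h.  A class is represented by a function that coincides with its
   polynomials everywhere on the open elements, so that [tr] applies. *)
Definition Vh (k : nat) (v : vfield) : Prop :=
  Lpv 2%:E Omega v /\
  forall K, exists2 p, Pkv k p & forall x, otet (Th K) x -> v x = p x.

(* The polynomials on a facet are the restrictions of those on R^3. *)
Definition Mh (k : nat) (mu : vfield) : Prop :=
  forall K j,
    (forall i, fL2 (Th K) j (coord mu i)) /\
    exists2 p, Pkv k p & forall x, ofacet (Th K) j x -> mu x = p x.

Definition ipT (T : tetra) (u v : vfield) : R :=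
  vint (otet T) (fun x => dot (u x) (v x)).

Definition ipF (T : tetra) (j : 'I_4) (u v : vfield) : R :=
  fint T j (fun x => dot (u x) (v x)).

Definition ipTh (u v : vfield) : R := \sum_K ipT (Th K) u v.

(* On a facet, integrands depend on the element from which it is seen. *)
Definition ipdTh (u v : 'I_N -> 'I_4 -> vfield) : R :=
  \sum_K \sum_j ipF (Th K) j (u K j) (v K j).

Definition ipdTh_int (u v : 'I_N -> 'I_4 -> vfield) : R :=
  \sum_K \sum_(j | ~~ `[< bfacet Omega (Th K) j >])
    ipF (Th K) j (u K j) (v K j).

(* A boundary facet belongs to exactly one element. *)
Definition ipFh_bnd (u v : 'I_N -> 'I_4 -> vfield) : R :=
  \sum_K \sum_(j | `[< bfacet Omega (Th K) j >])
    ipF (Th K) j (u K j) (v K j).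

Variables (k : nat) (eps : R) (beta : vfield) (gamma : 'rV[R]_3 -> R).
Variables (f g : vfield) (taut taun : 'I_N -> 'I_4 -> R).

Definition Lbeta (T : tetra) (v : vfield) : vfield :=
  fun x => wcurl (otet T) (fun y => cross (beta y) (v y)) x
           - div v x *: beta x.

(* L_beta v + gamma v, element by element. *)
Definition advect (v : vfield) : 'I_N -> vfield :=
  fun K x => Lbeta (Th K) v x + gamma x *: v x.

Definition Gamma_minus K j : set 'rV[R]_3 :=
  [set x | bnd Omega x /\ dot (tr (Th K) beta x) (normal (Th K) j) < 0].

Definition Gamma_plus K j : set 'rV[R]_3 :=
  [set x | bnd Omega x /\ 0 <= dot (tr (Th K) beta x) (normal (Th K) j)].

Section Fluxes.
Variables (wh uh uhat : vfield).

Definition w_hat K j : vfield := fun x =>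
  tr (Th K) wh x
  + taut K j *: cross (tr (Th K) uh x - uhat x) (normal (Th K) j).

Definition beta_u_hat K j : 'rV[R]_3 -> R := fun x =>
  dot (tr (Th K) beta x) (uhat x)
  + taun K j * dot (tr (Th K) uh x - uhat x) (normal (Th K) j).

Definition hdg_eq1 : Prop := forall r, Vh k r ->
  ipTh (fun x => eps^-1 *: wh x) r
  - ipTh uh (curl r)
  + ipdTh (fun _ _ => uhat)
      (fun K j x => cross (normal (Th K) j) (tr (Th K) r x)) = 0.

Definition hdg_eq2 : Prop := forall v, Vh k v ->
  ipTh wh (curl v)
  + ipdTh (fun K j x => cross (normal (Th K) j) (w_hat K j x))
      (fun K _ => tr (Th K) v)
  + \sum_K ipT (Th K) uh (advect v K)
  + ipdTh (fun K j x => cross (normal (Th K) j) (uhat x))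
      (fun K _ x => cross (tr (Th K) beta x) (tr (Th K) v x))
  + \sum_K \sum_j fint (Th K) j
      (fun x => beta_u_hat K j x * dot (normal (Th K) j) (tr (Th K) v x))
  = ipTh f v.

Definition hdg_eq3 : Prop := forall mu, Mh k mu ->
  - ipdTh_int
      (fun K j x =>
         cross (normal (Th K) j) (w_hat K j x)
         - cross (tr (Th K) beta x) (cross (normal (Th K) j) (uhat x))
         + beta_u_hat K j x *: normal (Th K) j)
      (fun _ _ => mu) = 0.

Definition hdg_eq4 : Prop := forall mu, Mh k mu ->
  ipFh_bnd
    (fun K j x =>
       cross (normal (Th K) j) (uhat x)
       + (\1_(Gamma_minus K j) x * dot (uhat x) (normal (Th K) j))
           *: normal (Th K) j
       - (\1_(Gamma_plus K j) x * taun K j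
            * dot (tr (Th K) uh x - uhat x) (normal (Th K) j))
           *: normal (Th K) j)
    (fun _ _ => mu)
  = ipFh_bnd (fun _ _ => g) (fun _ _ => mu).

Definition HDG_solution : Prop :=
  [/\ Vh k wh, Vh k uh & Mh k uhat] /\
  [/\ hdg_eq1, hdg_eq2, hdg_eq3 & hdg_eq4].

End Fluxes.
End HDG.

Section Postprocessing.
Variable R : realType.
Local Notation tetra := ('I_4 -> 'rV[R]_3).
Local Notation vfield := ('rV[R]_3 -> 'rV[R]_3).

Definition postprocessed (k : nat) (T : tetra) (uh uhat us : vfield) : Prop :=
  [/\ Pkv k.+1 us,
      forall r, (exists2 z, Pkv k.+1 z & r = curl z) ->
        ipT T (fun x => us x - uh x) (curl r)
        + \sum_j ipF T j
            (fun x => cross (normal T j) (us x) - cross (normal T j) (uhat x))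
            r = 0
    & forall v, Pk k.+2 v -> ipT T (fun x => us x - uh x) (grad v) = 0].

End Postprocessing.

(* Main.v *)
Require Import Defs.
From HB Require Import structures.
From mathcomp Require Import all_boot all_order all_algebra.
From mathcomp Require Import all_classical all_reals all_analysis.
From mathcomp Require Import measurable_realfun perm fingroup ring lra.
From mathcomp Require mpoly.
Import -(notations) mpoly.
Import Order.TTheory GRing.Theory Num.Theory.
Import numFieldNormedType.Exports.
Set Implicit Arguments.
Unset Strict Implicit.
Unset Printing Implicit Defensive.
Local Open Scope classical_set_scope.
Local Open Scope ring_scope.

(* On a nondegenerate tetrahedron T, integration by parts turns the first family
   of equations into (curl u*, r)_T = (u_h, curl r)_T + <n x uhat_h, r>_dT for all
   r in curl P_{k+1}.  Existence: let c = curl z be the Riesz representative of the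
   right-hand side in curl P_{k+1}, and grad v the one of (u_h - z, .)_T in
   grad P_{k+2}; then u* = z + grad v.  Uniqueness: the difference d of two
   solutions satisfies (curl d, curl d)_T = 0, hence curl d = 0, so d = grad v with
   v in P_{k+2} by the Poincare lemma, and (d, grad v)_T = 0 gives d = 0.
   As u_h and uhat_h are polynomial on T and on each facet, everything reduces to
   polynomials.  The divergence theorem for polynomials on T is obtained from the
   change of variables to the reference tetrahedron, where the derivative along an
   edge from T 0 becomes a partial derivative that Fubini integrates exactly. *)

(** The measure [leb3] is an iterated product, so the change of variables rests on maps that alter
    one coordinate at a time: each is affine in that coordinate, and slicing reduces it to the line.
    A general invertible matrix is brought to such maps by its LUP factorization: triangular factors
    update the coordinates one after another, and permutations are products of shears and
    reflections. Exact integration along a coordinate yields only derivatives along the three edges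
    from [T ord0]; as these edges form a basis, linearity in the direction recovers every partial
    derivative, and the facet normals are identified by their products with the edges. The Riesz
    representatives are taken over linearly dependent spanning families, since curl kills gradients
    and grad kills constants; the Gram matrix may thus be singular, and it is the definiteness of
    the inner product that makes the system consistent. *)

Section Index3.
Lemma ord3P (P : 'I_3 -> Prop) : P 0 -> P 1 -> P 2%:R -> forall i, P i.
Proof.
move=> P0 P1 P2 -[[|[|[|//]]] im].
- by rewrite (_ : Ordinal im = 0)//; exact: val_inj.
- by rewrite (_ : Ordinal im = 1)//; exact: val_inj.
- by rewrite (_ : Ordinal im = 2%:R)//; exact: val_inj.
Qed.

Lemma sum3E (V : nmodType) (F : 'I_3 -> V) : \sum_i F i = F 0 + F 1 + F 2%:R.
Proof.
rewrite !big_ord_recl big_ord0 addr0 addrA.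
by congr (F _ + F _ + F _); exact: val_inj.
Qed.

Lemma prod3E (V : comNzRingType) (F : 'I_3 -> V) : \prod_i F i = F 0 * F 1 * F 2%:R.
Proof.
rewrite !big_ord_recl big_ord0 mulr1 mulrA.
by congr (F _ * F _ * F _); exact: val_inj.
Qed.

Lemma ord3_01 : 0 + 1 = 1 :> 'I_3. Proof. exact: val_inj. Qed.
Lemma ord3_02 : 0 + 2%:R = 2%:R :> 'I_3. Proof. exact: val_inj. Qed.
Lemma ord3_11 : 1 + 1 = 2%:R :> 'I_3. Proof. exact: val_inj. Qed.
Lemma ord3_12 : 1 + 2%:R = 0 :> 'I_3. Proof. exact: val_inj. Qed.
Lemma ord3_21 : 2%:R + 1 = 0 :> 'I_3. Proof. exact: val_inj. Qed.
Lemma ord3_22 : 2%:R + 2%:R = 1 :> 'I_3. Proof. exact: val_inj. Qed.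
Definition ord3D := (ord3_01, ord3_02, ord3_12, ord3_21, ord3_22, ord3_11).
End Index3.

(** * Change of variables for Lebesgue measure *)

Section Scaling.
Context d (T : measurableType d) (R : realType).
Implicit Types (mu : {measure set T -> \bar R}) (S : T -> T) (c : R).

(** Says that the pushforward of [mu] by [S] is [c * mu]. Preimages rather than images avoid any
    inverse of [S]; for a linear map [c] is the reciprocal of the absolute determinant. *)
Definition scales mu S c : Prop :=
  [/\ measurable_fun [set: T] S, 0 <= c &
      forall E, measurable E -> mu (S @^-1` E) = (c%:E * mu E)%E].

Lemma scales_comp mu S S' c c' :
  scales mu S c -> scales mu S' c' -> scales mu (S' \o S) (c * c').
Proof.
move=> [mS c0 muS] [mS' c'0 muS']; split; first exact: measurableT_comp.
  exact: mulr_ge0.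
move=> E mE; rewrite comp_preimage muS ?muS' ?EFinM ?muleA//.
by rewrite -[X in measurable X]setTI; exact: mS'.
Qed.

Lemma ge0_integral_scales mu S c (D : set T) (f : T -> \bar R) : scales mu S c ->
  measurable D -> measurable_fun D f -> (forall x, 0 <= f x)%E ->
  (\int[mu]_(x in S @^-1` D) f (S x) = c%:E * \int[mu]_(x in D) f x)%E.
Proof.
move=> [mS c0 muS] mD mf f0.
pose c' := NngNum c0.
transitivity (\int[pushforward mu S]_(x in D) f x)%E.
  by rewrite ge0_integral_pushforward.
transitivity (\int[mscale c' mu]_(x in D) f x)%E.
  by apply: eq_measure_integral => // A mA _; exact: muS.
by rewrite ge0_integral_mscale.
Qed.

Lemma Rintegral_scales mu S c (D : set T) (f : T -> R) : scales mu S c ->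
  measurable D -> mu.-integrable D (EFin \o f) ->
  \int[mu]_(x in S @^-1` D) f (S x) = c * \int[mu]_(x in D) f x.
Proof.
move=> sS mD fi; have mf := measurable_int _ fi.
rewrite /Rintegral (_ : c = fine c%:E)// -fineM//; last exact: integrable_fin_num.
congr fine; rewrite integralE [in RHS]integralE.
rewrite muleBr//; last exact: integrable_add_def.
have Ep := ge0_integral_scales sS mD (measurable_funepos mf) (fun x => funepos_ge0 _ x).
have En := ge0_integral_scales sS mD (measurable_funeneg mf) (fun x => funeneg_ge0 _ x).
congr (_ - _)%E.
  by rewrite -[RHS]Ep; apply: eq_integral => x _; rewrite !funeposE.
by rewrite -[RHS]En; apply: eq_integral => x _; rewrite !funenegE.
Qed.
End Scaling.

Section ProductScaling.
Context d1 d2 (T1 : measurableType d1) (T2 : measurableType d2) (R : realType).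
Variable m1 : {sigma_finite_measure set T1 -> \bar R}.
Variable m2 : {sigma_finite_measure set T2 -> \bar R}.
Local Open Scope ereal_scope.

(** For fixed [x], the section of the preimage of [E] is the preimage by [h x] of the section of
    [E], so [c] factors out of the iterated integral. *)
Lemma scales_snd (h : T1 -> T2 -> T2) (c : R) :
  measurable_fun [set: T1 * T2] (fun p => h p.1 p.2) ->
  (0 <= c)%R -> (forall x, scales m2 (h x) c) ->
  scales (m1 \x m2) (fun p => (p.1, h p.1 p.2)) c.
Proof.
move=> mh c0 hc; split=> //; first exact: measurable_fun_pair.
move=> E mE /=; rewrite /product_measure1.
rewrite -ge0_integralZl//.
  apply: eq_integral => x _ /=.
  case: (hc x) => _ _ hE; rewrite -hE//; exact: measurable_xsection.
exact: measurable_fun_xsection.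
Qed.

(** Both orders of iterated integration agree on rectangles, hence on all measurable sets;
    [scales_fst] slices along the other factor. *)
Lemma product_measure12 (E : set (T1 * T2)) : measurable E ->
  (m1 \x m2) E = (m1 \x^ m2) E.
Proof.
by move=> mE; apply: product_measure_unique => // A B mA mB; exact: product_measure2E.
Qed.

Lemma scales_fst (h : T2 -> T1 -> T1) (c : R) :
  measurable_fun [set: T1 * T2] (fun p => h p.2 p.1) ->
  (0 <= c)%R -> (forall x, scales m1 (h x) c) ->
  scales (m1 \x m2) (fun p => (h p.2 p.1, p.2)) c.
Proof.
move=> mh c0 hc.
have mS : measurable_fun [set: T1 * T2] (fun p => (h p.2 p.1, p.2)).
  exact: measurable_fun_pair.
split=> // E mE /=.
rewrite !product_measure12//; last by rewrite -[X in measurable X]setTI; exact: mS.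
rewrite /product_measure2 -ge0_integralZl//.
  apply: eq_integral => x _ /=.
  case: (hc x) => _ _ hE; rewrite -hE//; exact: measurable_ysection.
exact: measurable_fun_ysection.
Qed.
End ProductScaling.

Section Lebesgue.
Variable R : realType.
Local Notation mu := (@lebesgue_measure R).

(** Lebesgue measure is the only measure giving half-open intervals their length, and [|a|] times
    the pushforward does so. *)
Lemma scales_affine (a b : R) : a != 0 ->
  scales mu (fun x => a * x + b) `|a|^-1.
Proof.
move=> a0.
pose S (x : measurableTypeR R) : measurableTypeR R := a * x + b.
have mS : measurable_fun [set: measurableTypeR R] S.
  by apply: measurable_funD => //; apply: measurable_funM.
have na0 : 0 < `|a| by rewrite normr_gt0.
split; [exact: mS|by rewrite invr_ge0|].
move=> E mE.
pose c := NngNum (ltW na0).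
pose nu : {measure set (measurableTypeR R) -> \bar R} :=
  measure_function_pushforward__canonical__measure_function_Measure mu mS.
have H : mu E = (`|a|%:E * mu ((fun x : R => a * x + b)%R @^-1` E))%E.
  have -> : (`|a|%:E * mu ((fun x : R => a * x + b)%R @^-1` E))%E =
     mscale c nu E by [].
  pose nu' : {measure set (measurableTypeR R) -> \bar R} := mscale c nu.
  apply: (@lebesgue_measure_unique R nu') => // _ [[x y] _ <-].
  have -> : nu' `]x, y]%classic = (`|a|%:E * mu (S @^-1` `]x, y]%classic))%E by [].
  have [a_gt0|a_lt0|/eqP] := ltgtP a 0; last by rewrite (negPf a0).
  (* A negative slope reverses the interval and exchanges the closed end with the open one; the
     measure does not see it. *)
  - have -> : S @^-1` `]x, y]%classic = `[(y - b) / a, (x - b) / a[%classic.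
      apply/seteqP; split=> z /=;
        rewrite /S !in_itv/= ?ler_ndivrMr ?ltr_ndivlMr// => /andP[? ?]; apply/andP;
          split; lra.
    rewrite !lebesgue_measure_itv/= !lte_fin ltr_nM2r ?invr_lt0// ltrD2r.
    case: ifP => xy; rewrite ?mule0// -!EFinB -EFinM; congr (_%:E).
    by rewrite ltr0_norm//; field.
  - have -> : S @^-1` `]x, y]%classic = `](x - b) / a, (y - b) / a]%classic.
      apply/seteqP; split=> z /=;
        rewrite /S !in_itv/= ?ler_pdivlMr ?ltr_pdivrMr// => /andP[? ?]; apply/andP;
          split; lra.
    rewrite !lebesgue_measure_itv/= !lte_fin ltr_pM2r ?invr_gt0// ltrD2r.
    case: ifP => xy; rewrite ?mule0// -!EFinB -EFinM; congr (_%:E).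
    by rewrite gtr0_norm//; field.
transitivity (`|a|^-1%:E * (`|a|%:E * mu (S @^-1` E)))%E.
  by rewrite muleA -EFinM mulVf ?mul1e// lt0r_neq0.
by congr (_ * _)%E; exact: esym H.
Qed.
End Lebesgue.

Section SigmaFinite.
Context d1 d2 (T1 : measurableType d1) (T2 : measurableType d2) (R : realType).
Variable m1 : {sigma_finite_measure set T1 -> \bar R}.
Variable m2 : {sigma_finite_measure set T2 -> \bar R}.
Local Open Scope ereal_scope.

Lemma sigma_finite_product : sigma_finite setT (m1 \x m2).
Proof.
have /sigma_finiteP[F [TF ndF Foo]] := sigma_finiteT m1.
have /sigma_finiteP[G [TG ndG Goo]] := sigma_finiteT m2.
exists (fun n => F n `*` G n) => [|n].
  apply/seteqP; split=> // -[x y] _.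
  have [i _ Fx] : (\bigcup_i F i) x by rewrite -TF.
  have [j _ Gy] : (\bigcup_j G j) y by rewrite -TG.
  exists (maxn i j) => //; split.
    by have /subsetPset := ndF _ _ (leq_maxl i j); exact.
  by have /subsetPset := ndG _ _ (leq_maxr i j); exact.
have [mF Fn] := Foo n; have [mG Gn] := Goo n.
split; first exact: measurableX.
by rewrite product_measure1E// lte_mul_pinfty// ge0_fin_numE.
Qed.

End SigmaFinite.

(* The library only declares product measures to be sigma-finite when both
   factors are subprobabilities. *)
HB.instance Definition _ (R : realType) := measure_function.Measure.copy
  (@leb2 R) (@lebesgue_measure R \x @lebesgue_measure R)%E.
HB.instance Definition _ (R : realType) := Measure_isSigmaFinite.Build _ _ _
  (@leb2 R) (sigma_finite_product (@lebesgue_measure R) (@lebesgue_measure R)).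
HB.instance Definition _ (R : realType) := measure_function.Measure.copy
  (@leb3 R) (@leb2 R \x @lebesgue_measure R)%E.
HB.instance Definition _ (R : realType) := Measure_isSigmaFinite.Build _ _ _
  (@leb3 R) (sigma_finite_product (@leb2 R) (@lebesgue_measure R)).

(** [is_trig_mx] means lower triangular, so [U] being upper triangular is stated on its
    transpose. *)
Lemma lup_decomposition (F : fieldType) n (A : 'M[F]_n.+1) :
  exists (s : 'S_n.+1) (L U : 'M[F]_n.+1),
    [/\ perm_mx s *m A = L *m U, \det L = 1, is_trig_mx L & is_trig_mx U^T].
Proof.
have := cormen_lup_correct A; have := cormen_lup_perm A.
have := cormen_lup_detL A; have := @cormen_lup_lower _ _ A;
  have := @cormen_lup_upper _ _ A.
case: (cormen_lup A) => -[P L] U /= up lo dL /is_perm_mxP[s ->] E.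
exists s, L, U; split=> //; apply/is_trig_mxP => i j ij.
  by rewrite (lo _ _ (ltnW ij)) -val_eqE/= (ltn_eqF ij).
by rewrite mxE (up _ _ ij).
Qed.

(** * Affine changes of variables in dimensions 2 and 3 *)

Section Lebesgue23.
Variable R : realType.
Local Notation mu := (@lebesgue_measure R).
Local Notation leb2 := (@leb2 R).
Local Notation leb3 := (@leb3 R).

Lemma scales2_snd (a b c : R) : b != 0 ->
  scales leb2 (fun p => (p.1, b * p.2 + (a * p.1 + c))) `|b|^-1.
Proof.
move=> b0; apply: (@scales_snd _ _ _ _ R mu mu (fun x y => b * y + (a * x + c))).
- apply: measurable_funD; first by apply: measurable_funM => //; exact: measurable_snd.
  by apply: measurable_funD => //; apply: measurable_funM => //; exact: measurable_fst.
- by rewrite invr_ge0.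
- by move=> x; exact: scales_affine.
Qed.

Lemma scales2_fst (a b c : R) : a != 0 ->
  scales leb2 (fun p => (a * p.1 + (b * p.2 + c), p.2)) `|a|^-1.
Proof.
move=> a0; apply: (@scales_fst _ _ _ _ R mu mu (fun y x => a * x + (b * y + c))).
- apply: measurable_funD; first by apply: measurable_funM => //; exact: measurable_fst.
  by apply: measurable_funD => //; apply: measurable_funM => //; exact: measurable_snd.
- by rewrite invr_ge0.
- by move=> x; exact: scales_affine.
Qed.

Lemma measurable_pr1 : measurable_fun [set: R * R * R] (fun p => p.1.1).
Proof. by apply: measurableT_comp; [exact: measurable_fst|exact: measurable_fst]. Qed.

Lemma measurable_pr2 : measurable_fun [set: R * R * R] (fun p => p.1.2).
Proof. by apply: measurableT_comp; [exact: measurable_snd|exact: measurable_fst]. Qed.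

Lemma scales3_snd (a b c e : R) : c != 0 ->
  scales leb3 (fun p => (p.1, c * p.2 + (a * p.1.1 + b * p.1.2 + e))) `|c|^-1.
Proof.
move=> c0; apply: (@scales_snd _ _ _ _ R leb2 mu
  (fun q z => c * z + (a * q.1 + b * q.2 + e))).
- have m1 := measurable_pr1; have m2 := measurable_pr2.
  apply: measurable_funD; first by apply: measurable_funM => //; exact: measurable_snd.
  by apply: measurable_funD => //; apply: measurable_funD => //; apply: measurable_funM.
- by rewrite invr_ge0.
- by move=> x; exact: scales_affine.
Qed.

Lemma scales3_fst (h : R -> R * R -> R * R) c :
  measurable_fun [set: R * R * R] (fun p => (h p.2 p.1).1) ->
  measurable_fun [set: R * R * R] (fun p => (h p.2 p.1).2) ->
  (forall z, scales leb2 (h z) c) ->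
  scales leb3 (fun p => (h p.2 p.1, p.2)) c.
Proof.
move=> m1 m2 hc; apply: (@scales_fst _ _ _ _ R leb2 mu h) => //.
  have -> : (fun p : R * R * R => h p.2 p.1) =
    (fun p => ((h p.2 p.1).1, (h p.2 p.1).2)).
    by apply/funext => p; case: (h _ _).
  exact: measurable_fun_pair.
by case: (hc 0).
Qed.

(** A row vector times a lower triangular matrix. Component i reads only the coordinates from i on,
    so updating them in increasing order never needs an overwritten value. *)
Lemma scales3_lower (a b c d e f : R) : a != 0 -> c != 0 -> f != 0 ->
  scales leb3 (fun p => (a * p.1.1 + b * p.1.2 + d * p.2, c * p.1.2 + e * p.2, f * p.2))
    (`|a|^-1 * `|c|^-1 * `|f|^-1).
Proof.
move=> a0 c0 f0.
(* The zero coefficient gives [h] literally the shape of [scales2_fst] followed by [scales2_snd]. *)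
pose h z (q : R * R) := (a * q.1 + (b * q.2 + d * z), c * q.2 + (0 * (a * q.1 + (b
  * q.2 + d * z)) + e * z)).
have hE : scales leb3 (fun p => (h p.2 p.1, p.2)) (`|a|^-1 * `|c|^-1).
  have m1 := measurable_pr1; have m2 := measurable_pr2.
  have m3 : measurable_fun [set: R * R * R] (fun p => p.2) by exact: measurable_snd.
  have m4 : measurable_fun [set: R * R * R] (fun p => a * p.1.1 + (b * p.1.2 + d *
    p.2)).
    by apply: measurable_funD; [|apply: measurable_funD]; apply: measurable_funM.
  apply: scales3_fst => //=.
    by apply: measurable_funD; [|apply: measurable_funD]; apply: measurable_funM.
  by move=> z; apply: (scales_comp (scales2_fst b (d * z) a0) (scales2_snd 0 (e *
    z) c0)).
have := scales_comp hE (scales3_snd 0 0 0 f0).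
congr scales; apply/funext => -[[x y] z] /=.
by move: (x : R) (y : R) (z : R) => {x y z} x y z; congr (_, _, _); rewrite /h/=; ring.
Qed.

(** The transposed situation: the coordinates are updated in decreasing order. *)
Lemma scales3_upper (a b c d e f : R) : a != 0 -> c != 0 -> f != 0 ->
  scales leb3 (fun p => (a * p.1.1, b * p.1.1 + c * p.1.2, d * p.1.1 + e * p.1.2 +
    f * p.2))
    (`|a|^-1 * `|c|^-1 * `|f|^-1).
Proof.
move=> a0 c0 f0.
pose h (z : R) (q : R * R) := (a * q.1 + (0 * (c * q.2 + (b * q.1 + 0)) + 0), c *
  q.2 + (b * q.1 + 0)).
have hE : scales leb3 (fun p => (h p.2 p.1, p.2)) (`|c|^-1 * `|a|^-1).
  have m1 := measurable_pr1; have m2 := measurable_pr2.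
  have m3 : measurable_fun [set: R * R * R] (fun p => c * p.1.2 + (b * p.1.1 + 0)).
    by apply: measurable_funD; [|apply: measurable_funD => //]; apply: measurable_funM.
  apply: scales3_fst => //=.
    by apply: measurable_funD; [|apply: measurable_funD => //]; apply: measurable_funM.
  by move=> z; apply: (scales_comp (scales2_snd b 0 c0) (scales2_fst 0 0 a0)).
have := scales_comp (scales3_snd d e 0 f0) hE.
rewrite [X in scales _ _ X](_ : _ = `|a|^-1 * `|c|^-1 * `|f|^-1); last by ring.
congr scales; apply/funext => -[[x y] z] /=.
by move: (x : R) (y : R) (z : R) => {x y z} x y z; congr (_, _, _); rewrite /h/=; ring.
Qed.

Lemma scales3_translation (a b c : R) :
  scales leb3 (fun p => (p.1.1 + a, p.1.2 + b, p.2 + c)) 1.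
Proof.
have n1 : (1 : R) != 0 by rewrite oner_eq0.
pose h (z : R) (q : R * R) := (1 * q.1 + (0 * q.2 + a), 1 * q.2 + (0 * (1 * q.1 +
  (0 * q.2 + a)) + b)).
have hE : scales leb3 (fun p => (h p.2 p.1, p.2)) (`|1|^-1 * `|1|^-1).
  have m1 := measurable_pr1; have m2 := measurable_pr2.
  have m3 : measurable_fun [set: R * R * R] (fun p => 1 * p.1.1 + (0 * p.1.2 + a)).
    by apply: measurable_funD; [|apply: measurable_funD => //]; apply: measurable_funM.
  apply: scales3_fst => //=.
    by apply: measurable_funD; [|apply: measurable_funD => //]; apply: measurable_funM.
  by move=> z; apply: (scales_comp (scales2_fst 0 a n1) (scales2_snd 0 b n1)).
have := scales_comp hE (scales3_snd 0 0 c n1).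
rewrite normr1 invr1 !mulr1.
congr scales; apply/funext => -[[x y] z] /=.
by move: (x : R) (y : R) (z : R) => {x y z} x y z; congr (_, _, _); rewrite /h/=; ring.
Qed.


Definition unpt (v : 'rV[R]_3) : R * R * R := (v 0 0, v 0 1, v 0 2%:R).

Lemma pt0 (p : R * R * R) : pt p 0 0 = p.1.1. Proof. by rewrite mxE. Qed.
Lemma pt1 (p : R * R * R) : pt p 0 1 = p.1.2. Proof. by rewrite mxE. Qed.
Lemma pt2 (p : R * R * R) : pt p 0 2%:R = p.2. Proof. by rewrite mxE. Qed.

Lemma unptK : cancel unpt (@pt R).
Proof.
by move=> v; apply/rowP; apply: ord3P; rewrite ?pt0 ?pt1 ?pt2.
Qed.

Lemma ptK : cancel (@pt R) unpt.
Proof. by move=> [[x y] z]; rewrite /unpt pt0 pt1 pt2. Qed.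

Definition pt_mulmx (M : 'M[R]_3) (p : R * R * R) := unpt (pt p *m M).

Definition scales_mulmx M := M \in unitmx /\ scales leb3 (pt_mulmx M) `|\det M|^-1.

Lemma scales_mulmx_mul M M' : scales_mulmx M -> scales_mulmx M' -> scales_mulmx (M
  *m M').
Proof.
move=> [u s] [u' s']; split; first by rewrite unitmx_mul u.
rewrite det_mulmx normrM invfM; have := scales_comp s s'.
by congr scales; apply/funext => p; rewrite /= /pt_mulmx unptK mulmxA.
Qed.

Lemma scales_mulmx_lower M : M \in unitmx -> is_trig_mx M -> scales_mulmx M.
Proof.
move=> uM tM; split=> //; move: uM; rewrite unitmxE (det_trig tM) prod3E unitfE.
rewrite !mulf_eq0 !negb_or => /andP[/andP[a0 c0] f0].
have := scales3_lower (M 1 0) (M 2%:R 0) (M 2%:R 1) a0 c0 f0.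
rewrite !normrM !invfM; congr scales; apply/funext => p;
  rewrite /pt_mulmx /unpt !mxE !sum3E !pt0 !pt1 !pt2.
have /is_trig_mxP z := tM.
rewrite (z 0 1)// (z 0 2%:R)// (z 1 2%:R)// !mulr0 !add0r.
by congr (_, _, _); rewrite !(mulrC (M _ _)).
Qed.

Lemma scales_mulmx_upper M : M \in unitmx -> is_trig_mx M^T -> scales_mulmx M.
Proof.
move=> uM tM; split=> //; move: uM; rewrite unitmxE -det_tr (det_trig tM) prod3E unitfE.
rewrite !mulf_eq0 !negb_or !mxE => /andP[/andP[a0 c0] f0].
have := scales3_upper (M 0 1) (M 0 2%:R) (M 1 2%:R) a0 c0 f0.
rewrite !normrM !invfM; congr scales; apply/funext => p;
  rewrite /pt_mulmx /unpt !mxE !sum3E !pt0 !pt1 !pt2.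
have z (i j : 'I_3) : (i < j)%N -> M j i = 0.
  by move=> ij; move/is_trig_mxP : tM => /(_ i j ij); rewrite mxE.
rewrite (z 0 1)// (z 0 2%:R)// (z 1 2%:R)// !mulr0 !addr0.
by congr (_, _, _); rewrite !(mulrC (M _ _)).
Qed.

(** For [i = j] this is the dilation of axis [i] by [1 + a], so that reflections are covered too. *)
Definition shear (i j : 'I_3) (a : R) : 'M[R]_3 := 1%:M + a *: delta_mx i j.

Lemma scales_mulmx_shear i j a : shear i j a \in unitmx -> scales_mulmx (shear i j a).
Proof.
move=> u; have [ij|ij] := leqP j i.
  apply: scales_mulmx_lower => //; apply/is_trig_mxP => k l kl.
  rewrite !mxE -val_eqE/= ltn_eqF// add0r.
  have [ki|]/= := eqVneq k i; last by rewrite mulr0.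
  have [lj|]/= := eqVneq l j; last by rewrite mulr0.
  by move: kl; rewrite ki lj ltnNge ij.
apply: scales_mulmx_upper => //; apply/is_trig_mxP => k l kl.
rewrite !mxE -val_eqE/= gtn_eqF// add0r.
have [li|]/= := eqVneq l i; last by rewrite mulr0.
have [kj|]/= := eqVneq k j; last by rewrite mulr0.
by move: kl; rewrite li kj ltnNge (ltnW ij).
Qed.

Lemma mul_shear i j a b : shear i j a *m shear i j b =
  1%:M + (a + b + a * b *+ (i == j)) *: delta_mx i j.
Proof.
rewrite /shear mulmxDl mul1mx mulmxDr mulmx1 -scalemxAl -scalemxAr.
rewrite mul_delta_mx_cond !scalerDl !addrA (addrAC _ (b *: _)) eq_sym.
by congr (_ + _); case: eqP => _; rewrite ?mulr0n ?mulr1n ?scaler0 ?scale0r ?scalerA.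
Qed.

Lemma unit_shear i j a : i != j -> shear i j a \in unitmx.
Proof.
move=> ij; suff /mulmx1_unit[]: shear i j a *m shear i j (- a) = 1%:M by [].
by rewrite mul_shear (negPf ij) subrr addr0 scale0r addr0.
Qed.

(* (x, y) -> (x + y, y) -> (x + y, - x) -> (y, - x) -> (y, x) *)
Lemma tperm_shear (i j : 'I_3) : i != j -> tperm_mx i j =
  shear j i 1 *m shear i j (-1) *m shear j i 1 *m shear j j (- 2%:R).
Proof.
move=> ij; rewrite /shear !scale1r scaleN1r.
have d (k l m n : 'I_3) : delta_mx k l *m delta_mx m n = delta_mx k n *+ (l == m)
  :> 'M[R]_3.
  exact: mul_delta_mx_cond.
rewrite !(mulmxDl, mulmxDr, mul1mx, mulmx1, mulmxN, mulNmx, d, eqxx, mulr1n, eq_sym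
  j i, negPf ij, mulr0n).
rewrite -!scalemxAr !d ?eqxx ?(eq_sym j i) ?(negPf ij) ?mulr1n ?mulr0n.
have ji : (j == i) = false by rewrite eq_sym (negPf ij).
apply/matrixP => k l; rewrite !(mul0mx, scaler0) !mxE permE /=.
have [->|ki] := eqVneq k i; last have [->|kj] := eqVneq k j.
- rewrite ?eqxx ?ji ?(negPf ij) (eq_sym i l) (eq_sym j l) /=.
  have [->|li] := eqVneq l i; rewrite ?ji ?(negPf ij) /=; first by ring.
  by have [_|_] := eqVneq l j; rewrite /=; ring.
- rewrite ?eqxx ?ji ?(negPf ij) (eq_sym i l) (eq_sym j l) /=.
  have [->|li] := eqVneq l i; rewrite ?ji ?(negPf ij) /=; first by ring.
  by have [_|_] := eqVneq l j; rewrite /=; ring.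
- by rewrite /=; ring.
Qed.

Lemma scales_mulmx_tperm (i j : 'I_3) : i != j -> scales_mulmx (tperm_mx i j).
Proof.
move=> ij; have ji : j != i by rewrite eq_sym.
(* The reflection of axis [j] is an involution, as -2 - 2 + 4 = 0. *)
have ujj : shear j j (- 2%:R) \in unitmx.
  suff /mulmx1_unit[]: shear j j (- 2%:R) *m shear j j (- 2%:R) = 1%:M by [].
  rewrite mul_shear eqxx mulr1n [X in X *: _](_ : _ = 0) ?scale0r ?addr0//; ring.
rewrite tperm_shear//; do 3?[apply: scales_mulmx_mul];
  apply: scales_mulmx_shear => //; exact: unit_shear.
Qed.

Lemma scales_mulmx_perm (s : 'S_3) : scales_mulmx (perm_mx s).
Proof.
have [ts -> ] := prod_tpermP s.
elim: ts => [|[i j] ts IH]/=.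
  rewrite big_nil perm_mx1 => _; apply: scales_mulmx_lower; first exact: unitmx1.
  by apply/is_trig_mxP => i j ij; rewrite mxE -val_eqE/= ltn_eqF.
move=> /andP[ij /IH gts]; rewrite big_cons perm_mxM; apply: scales_mulmx_mul => //.
exact: scales_mulmx_tperm.
Qed.

Lemma scales_mulmx_unit M : M \in unitmx -> scales_mulmx M.
Proof.
move=> uM; have [s [L [U [E dL tL tU]]]] := lup_decomposition M.
have uL : L \in unitmx by rewrite unitmxE dL unitr1.
have uU : U \in unitmx.
  have : perm_mx s *m M \in unitmx by rewrite unitmx_mul unitmx_perm.
  by rewrite E unitmx_mul => /andP[].
have -> : M = perm_mx s^-1 *m (L *m U).
  by rewrite -E mulmxA -perm_mxM mulVg perm_mx1 mul1mx.
apply: scales_mulmx_mul; first exact: scales_mulmx_perm.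
by apply: scales_mulmx_mul; [exact: scales_mulmx_lower|exact: scales_mulmx_upper].
Qed.

Lemma scales3_affine M t : M \in unitmx ->
  scales leb3 (fun p => unpt (pt p *m M + t)) `|\det M|^-1.
Proof.
move=> /scales_mulmx_unit[_ s];
  have := scales_comp s (scales3_translation (t 0 0) (t 0 1) (t 0 2%:R)).
by rewrite mulr1; congr scales; apply/funext => p; rewrite /pt_mulmx /unpt/= !mxE.
Qed.

End Lebesgue23.

(** * Polynomial functions *)

Section PolyFun.
Variable R : realType.
Local Notation poly3 := (mpoly 3 R).
Implicit Types (p q : poly3) (x v : 'rV[R]_3) (i j : 'I_3).

Definition pev p : 'rV[R]_3 -> R := fun x => meval (x 0) p.

Lemma pevD p q x : pev (p + q) x = pev p x + pev q x. Proof. exact: mevalD. Qed.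
Lemma pevB p q x : pev (p - q) x = pev p x - pev q x. Proof. exact: mevalB. Qed.
Lemma pevM p q x : pev (p * q) x = pev p x * pev q x. Proof. exact: mevalM. Qed.
Lemma pevZ c p x : pev (c *: p) x = c * pev p x. Proof. exact: mevalZ. Qed.
Lemma pev0 x : pev 0 x = 0. Proof. exact: meval0. Qed.
Lemma pevC c x : pev (mpolyC 3 c) x = c. Proof. exact: mevalC. Qed.
Lemma pevX i x : pev (mpolyX R (mnm1 i)) x = x 0 i. Proof. exact: mevalXU. Qed.
Lemma pev_sum I (r : seq I) (P : pred I) (F : I -> poly3) x :
  pev (\sum_(k <- r | P k) F k) x = \sum_(k <- r | P k) pev (F k) x.
Proof. exact: (raddf_sum (meval (x 0))). Qed.

(** Constants and variables generate the ring, so facts about evaluation that pass to sums and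
    products need no monomial computation. *)
Lemma mpoly_ring_ind (P : poly3 -> Prop) :
  (forall c, P (mpolyC 3 c)) -> (forall i, P (mpolyX R (mnm1 i))) ->
  (forall p q, P p -> P q -> P (p + q)) -> (forall p q, P p -> P q -> P (p * q)) ->
  forall p, P p.
Proof.
move=> PC PX PD PM.
have P1 : P 1 by exact: PC.
elim/mpolyind => [|c m p _ _ Pp]; first by rewrite -mpolyC0; exact: PC.
apply: (PD) => //; rewrite -mul_mpolyC; apply: (PM) => //.
rewrite mpolyXE_id; apply: (big_ind P) => [//||i _]; first exact: PM.
by elim: (m i) => [|n IHn]; rewrite ?expr0 // exprS; exact: PM.
Qed.

Lemma is_derive_coord x v i : is_derive x v (fun y : 'rV[R]_3 => y 0 i) (v 0 i).
Proof.
pose f (y : 'rV[R]_3) := y 0 i.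
have linf : linear f by move=> a y z; rewrite /f !mxE.
pose F : {linear _ -> _} := HB.pack f (GRing.isLinear.Build _ _ _ _ f linf).
have cF : continuous F by exact: coord_continuous.
have dF := linear_differentiable x cF.
apply: DeriveDef; first exact: diff_derivable.
by rewrite (@deriveE _ _ _ F)// (@diff_lin _ _ _ F).
Qed.

Lemma is_derive_pev x v p :
  is_derive x v (pev p) (\sum_i v 0 i * pev (mderiv i p) x).
Proof.
elim/mpoly_ring_ind: p => [c|k|p q dp dq|p q dp dq].
- rewrite (_ : pev (mpolyC 3 c) = cst c); last by apply/funext => y; rewrite pevC.
  rewrite big1 => [|i _]; first exact: is_derive_cst.
  by rewrite mderivC pev0 mulr0.
- rewrite (_ : pev _ = fun y => y 0 k); last by apply/funext => y; rewrite pevX.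
  rewrite (bigD1 k)//= big1 ?addr0; last first.
    move=> i ik; rewrite mderivX mnm1E eq_sym (negPf ik) scale0r pev0 mulr0//.
  rewrite mderivX mnm1E eqxx scale1r.
  have -> : mnm_sub (mnm1 k) (mnm1 k) = mnm0 by apply/mnmP => i;
    rewrite mnmBE subnn mnmE.
  by rewrite mpolyX0 [pev _ _]pevC mulr1; exact: is_derive_coord.
- rewrite (_ : pev _ = pev p + pev q); last by apply/funext => y; rewrite pevD.
  rewrite (eq_bigr (fun i => v 0 i * pev (mderiv i p) x + v 0 i * pev (mderiv i q)
    x)); last first.
    by move=> i _; rewrite mderivD pevD mulrDr.
  by rewrite big_split/=; exact: is_deriveD.
- rewrite (_ : pev _ = pev p * pev q); last by apply/funext => y; rewrite pevM.
  rewrite (eq_bigr (fun i => pev p x * (v 0 i * pev (mderiv i q) x) + pev q x * (v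
    0 i * pev (mderiv i p) x))); last first.
    by move=> i _; rewrite mderivM pevD !pevM; ring.
  by rewrite big_split/= -!mulr_sumr; exact: is_deriveM.
Qed.

Lemma partial_pev i p : partial i (pev p) = pev (mderiv i p).
Proof.
apply/funext => x; rewrite /partial; have dp := is_derive_pev x (delta_mx 0 i) p.
rewrite derive_val (bigD1 i)//= mxE !eqxx mul1r big1 ?addr0// => j ji.
by rewrite mxE (negPf ji) andbF mul0r.
Qed.

Lemma continuous_pev p : continuous (pev p).
Proof.
elim/mpoly_ring_ind: p => [c|k|p q dp dq|p q dp dq] x.
- rewrite (_ : pev (mpolyC 3 c) = cst c); first exact: cst_continuous.
  by apply/funext => y; rewrite pevC.
- rewrite (_ : pev _ = fun y => y 0 k); first exact: coord_continuous.
  by apply/funext => y; rewrite pevX.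
- rewrite (_ : pev _ = pev p + pev q); last by apply/funext => y; rewrite pevD.
  by apply: continuousD; [exact: dp|exact: dq].
- rewrite (_ : pev _ = pev p * pev q); last by apply/funext => y; rewrite pevM.
  by apply: continuousM; [exact: dp|exact: dq].
Qed.

Lemma bounded_pev p (B : R) : exists C : R, forall x,
  (forall i, `|x 0 i| <= B) -> `|pev p x| <= C.
Proof.
elim/mpoly_ring_ind: p => [c|k|p q [C dp] [D dq]|p q [C dp] [D dq]].
- by exists `|c| => x _; rewrite pevC.
- by exists B => x xB; rewrite pevX.
- exists (C + D) => x xB; rewrite pevD (le_trans (ler_normD _ _))//.
  by rewrite lerD ?dp ?dq.
- by exists (C * D) => x xB; rewrite pevM normrM ler_pM ?dp ?dq.
Qed.

Lemma pev_line p x v : exists q : {poly R}, forall t, pev p (x + t *: v) = q.[t].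
Proof.
elim/mpoly_ring_ind: p => [c|k|p1 p2 [q1 d1] [q2 d2]|p1 p2 [q1 d1] [q2 d2]].
- by exists c%:P => t; rewrite pevC hornerC.
- exists ((x 0 k)%:P + (v 0 k) *: 'X) => t.
  by rewrite pevX !mxE hornerD hornerZ hornerX hornerC mulrC.
- by exists (q1 + q2) => t; rewrite pevD hornerD d1 d2.
- by exists (q1 * q2) => t; rewrite pevM hornerM d1 d2.
Qed.

(** On the line from [x] to [y], [p] is a univariate polynomial that vanishes near 0, hence has more
    roots than its degree allows. *)
Lemma pev_locally0 p x : (\forall y \near x, pev p y = 0) -> forall y, pev p y = 0.
Proof.
move=> px y; have [q qE] := pev_line p x (y - x).
suff q0 : q = 0 by have := qE 1; rewrite q0 horner0 scale1r addrC subrK.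
have : \forall t \near (0 : R), pev p (x + t *: (y - x)) = 0.
  have : (fun t : R => x + t *: (y - x)) t @[t --> 0] --> x.
    rewrite -[X in _ --> X]addr0; apply: cvgD; first exact: cvg_cst.
    rewrite -(scale0r (y - x)); exact: cvgZr_tmp cvg_id.
  by move=> /(_ _ px).
move=> /nbhs_ballP[e /= e0 eq0].
apply/eqP/negP => /negP q0.
(* These are [size q] distinct roots, one too many. The shift by 2 keeps every point strictly inside
   the ball of radius [e]. *)
pose rs := [seq e / (n.+2)%:R | n <- iota 0 (size q)].
suff : (size rs < size q)%N by rewrite size_map size_iota ltnn.
apply: max_poly_roots q0 _ _.
  apply/allP => _ /mapP[n _ ->]; rewrite /root -qE; apply/eqP/eq0.
  rewrite /ball/= sub0r normrN gtr0_norm ?divr_gt0//.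
  by rewrite ltr_pdivrMr// ltr_pMr// ltr1n.
rewrite map_inj_uniq ?iota_uniq// => m n.
move=> /mulfI; rewrite gt_eqF// => /(_ isT)/invr_inj/eqP.
by rewrite eqr_nat => /eqP[].
Qed.

(** The constant coefficient is the value at 0; any other is, up to a nonzero integer factor, a
    coefficient of lower degree of a partial derivative, which vanishes identically as well. *)
Lemma pev_inj p : (forall x, pev p x = 0) -> p = 0.
Proof.
move=> p0; apply/mpolyP => m; rewrite mcoeff0.
have [d] := ubnP (mdeg m); elim: d => // d IHd in m p p0 *; rewrite ltnS => md.
have [/eqP|] := posnP (mdeg m).
  rewrite mdeg_eq0 => /eqP ->; rewrite -[RHS](p0 0).
  elim/mpoly_ring_ind: p {p0} => [c|k|p q dp dq|p q dp dq].
  - by rewrite pevC mcoeffC eqxx mulr1.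
  - by rewrite pevX mcoeffX mnm1_eq0 mxE.
  - by rewrite pevD mcoeffD dp dq.
  - by rewrite pevM rmorphM /= dp dq.
rewrite lt0n mdeg_eq0 => m0.
have [i mi] : exists i, (0 < m i)%N.
  apply/existsP; move: m0; apply: contraR; rewrite negb_exists => /forallP h.
  by apply/eqP/mnmP => i; rewrite mnmE; have := h i; rewrite -eqn0Ngt => /eqP.
have mE : m = mnm_add (mnm_sub m (mnm1 i)) (mnm1 i).
  by rewrite submK//; apply/mnm_lepP => j; rewrite mnm1E; case: eqP => // <-.
have : mcoeff (mnm_sub m (mnm1 i)) (mderiv i p) = 0.
  apply: IHd; last first.
    by move: md; rewrite {1}mE mdegD mdeg1 addn1.
  by move=> x; rewrite -partial_pev (_ : pev p = cst 0) ?/partial ?derive_cst//;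
    apply/funext => y; exact: p0.
rewrite mcoeff_mderiv -mE => /eqP; rewrite mulrn_eq0 /= => /eqP//.
Qed.

Lemma pev_ext p q : pev p = pev q -> p = q.
Proof.
move=> pq; apply/eqP; rewrite -subr_eq0; apply/eqP/pev_inj => x.
by rewrite pevB pq subrr.
Qed.

End PolyFun.

(** * Riesz representation in a finitely generated subspace *)

Section Riesz.
Variables (F : fieldType) (V : lmodType F) (I : finType) (e : I -> V).
Variables (b : V -> V -> F) (L : V -> F).
Hypotheses (bl : forall v, scalar (b^~ v)) (br : forall u, scalar (b u)).
Hypotheses (Ll : scalar L) (b0 : forall v, b v v = 0 -> v = 0).

(** The family [e] may be linearly dependent. The Gram system is consistent because a kernel vector
    of [G] gives a combination [v] with [b v v = 0], so that [v = 0] and [L v = 0]. *)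
Lemma riesz_span : exists c : I -> F,
  forall j, b (\sum_i c i *: e i) (e j) = L (e j).
Proof.
pose bfl v : {scalar V} := HB.pack (b^~ v) (GRing.isLinear.Build _ _ _ _ _ (bl v)).
pose bfr u : {scalar V} := HB.pack (b u) (GRing.isLinear.Build _ _ _ _ _ (br u)).
pose Lf : {scalar V} := HB.pack L (GRing.isLinear.Build _ _ _ _ _ Ll).
pose ev (i : 'I_#|I|) := e (enum_val i).
pose G := \matrix_(i, j) b (ev i) (ev j).
pose l : 'rV_#|I| := \row_j L (ev j).
have lin (f : {scalar V}) (x : 'I_#|I| -> F) :
    f (\sum_j x j *: ev j) = \sum_j x j * f (ev j).
  by rewrite linear_sum; apply: eq_bigr => j _; rewrite linearZ.
have /submxP[c lE] : (l <= G)%MS.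
  rewrite submxE; apply/eqP/matrixP => i k; rewrite !mxE.
  pose v := \sum_j cokermx G j k *: ev j.
  rewrite (eq_bigr (fun j => cokermx G j k * Lf (ev j))) => [|j _];
    last by rewrite mxE mulrC.
  rewrite -lin (_ : \sum__ _ = 0) ?linear0//; apply: b0.
  rewrite -[LHS]/(bfl v v) lin big1// => j _.
  rewrite -[bfl v _]/(bfr (ev j) v) lin.
  have := mulmx_coker G => /matrixP/(_ j k); rewrite mxE [RHS]mxE => Gk.
  rewrite [X in _ * X](_ : _ = 0) ?mulr0// -[RHS]Gk; apply: eq_bigr => m _.
  by rewrite [G j m]mxE mulrC.
exists (fun i => c 0 (enum_rank i)) => j.
have -> : \sum_i c 0 (enum_rank i) *: e i = \sum_i c 0 i *: ev i.
  rewrite [RHS](reindex_onto (@enum_rank I) enum_val) /=.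
    by apply: eq_big => i; rewrite ?enum_rankK ?eqxx// /ev enum_rankK.
  by move=> i _; rewrite enum_valK.
rewrite -[LHS]/(bfl (e j) _) lin.
move/matrixP : lE => /(_ 0 (enum_rank j)); rewrite !mxE /ev enum_rankK => ->.
by apply: eq_bigr => i _; rewrite mxE /ev enum_rankK.
Qed.
End Riesz.

(** * Polynomial vector fields *)

Section VectorPoly.
Variable R : realType.
Local Notation poly3 := (mpoly 3 R).
Local Notation vpoly := {ffun 'I_3 -> poly3}.
Implicit Types (p q : poly3) (P Q U : vpoly) (x : 'rV[R]_3) (i j : 'I_3).

Definition pvec P : 'rV[R]_3 -> 'rV[R]_3 := fun x => \row_i pev (P i) x.
Definition pgrad p : vpoly := [ffun i => mderiv i p].
Definition pcurl P : vpoly :=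
  [ffun i => mderiv (i + 1) (P (i + 2%:R)) - mderiv (i + 2%:R) (P (i + 1))].
Definition pdiv P : poly3 := \sum_i mderiv i (P i).
Definition pdot P Q : poly3 := \sum_i P i * Q i.
Definition pcross P Q : vpoly :=
  [ffun i => P (i + 1) * Q (i + 2%:R) - P (i + 2%:R) * Q (i + 1)].

Lemma coord_pvec P i : Defs.coord (pvec P) i = pev (P i).
Proof. by apply/funext => x; rewrite /Defs.coord mxE. Qed.

Lemma grad_pev p : grad (pev p) = pvec (pgrad p).
Proof. by apply/funext => x; apply/rowP => i; rewrite !mxE ffunE partial_pev. Qed.

Lemma curl_pvec P : curl (pvec P) = pvec (pcurl P).
Proof.
apply/funext => x; apply/rowP => i.
by rewrite !mxE ffunE !coord_pvec !partial_pev pevB.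
Qed.

Lemma dot_pvec P Q x : dot (pvec P x) (pvec Q x) = pev (pdot P Q) x.
Proof. by rewrite /dot pev_sum; apply: eq_bigr => i _; rewrite !mxE pevM. Qed.

Lemma pvecB P Q x : pvec (P - Q) x = pvec P x - pvec Q x.
Proof. by apply/rowP => i; rewrite !mxE !ffunE pevB. Qed.

Lemma pdiv_cross P Q : pdiv (pcross P Q) = pdot (pcurl P) Q - pdot P (pcurl Q).
Proof.
rewrite /pdiv /pdot !sum3E !ffunE !ord3D !mderivB !mderivM.
ring.
Qed.

Lemma pcurl_grad p : pcurl (pgrad p) = 0.
Proof.
by apply/ffunP => i; rewrite !ffunE mderiv_comm subrr.
Qed.

Lemma pcurl_is_linear : linear pcurl.
Proof.
move=> a P Q; apply/ffunP => i; rewrite !ffunE !mderivD !mderivZ scalerBr.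
ring.
Qed.
HB.instance Definition _ := GRing.isLinear.Build _ _ _ _ pcurl pcurl_is_linear.

Lemma pgrad_is_linear : linear pgrad.
Proof. by move=> a p q; apply/ffunP => i; rewrite !ffunE mderivD mderivZ. Qed.
HB.instance Definition _ := GRing.isLinear.Build _ _ _ _ pgrad pgrad_is_linear.

Lemma pdot_is_linear P : linear (pdot P).
Proof.
move=> a Q1 Q2; rewrite /pdot scaler_sumr -big_split/=; apply: eq_bigr => i _.
by rewrite !ffunE mulrDr scalerAr.
Qed.
HB.instance Definition _ P := GRing.isLinear.Build _ _ _ _ (pdot P) (pdot_is_linear P).

Lemma pdotC P Q : pdot P Q = pdot Q P.
Proof. by apply: eq_bigr => i _; rewrite mulrC. Qed.

Lemma pcross_is_linear P : linear (pcross P).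
Proof.
move=> a Q1 Q2; apply/ffunP => i; rewrite !ffunE !mulrDr -!scalerAr scalerBr; ring.
Qed.
HB.instance Definition _ P := GRing.isLinear.Build _ _ _ _ (pcross P)
  (pcross_is_linear P).

Lemma msize_leP k p :
  reflect (forall m, (k <= mdeg m)%N -> mcoeff m p = 0) (msize p <= k)%N.
Proof.
apply: (iffP idP) => [pk m km|pk].
  by apply/memN_msupp_eq0/msize_mdeg_ge/(leq_trans pk).
rewrite msizeE; apply/bigmax_leqP_seq => m mp _; rewrite ltnNge.
by apply: contraL mp => /pk; rewrite mcoeff_msupp => ->; rewrite eqxx.
Qed.

(* The potential is x |-> int_0^1 x . U(t x) dt, written on coefficients: a
   monomial of total degree d is divided by d. *)
Lemma poincare (k : nat) U : pcurl U = 0 -> (forall i, msize (U i) <= k)%N ->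
  exists2 p, (msize p <= k.+1)%N & pgrad p = U.
Proof.
move=> U0 Uk.
have sym i j : mderiv i (U j) = mderiv j (U i).
  have c l : mderiv (l + 1) (U (l + 2%:R)) = mderiv (l + 2%:R) (U (l + 1)).
    by apply/eqP; rewrite -subr_eq0; move/ffunP : U0 => /(_ l); rewrite !ffunE => ->.
  have [c0 c1 c2] : [/\ mderiv 1 (U 2%:R) = mderiv 2%:R (U 1), mderiv 2%:R (U 0) =
    mderiv 0 (U 2%:R) & mderiv 0 (U 1) = mderiv 1 (U 0)].
    by have := c 0; have := c 1; have := c 2%:R; rewrite !ord3D.
  by elim/ord3P: i; elim/ord3P: j.
(* The coefficient of [m] in x_i U_i; the test guards the truncated subtraction of multi-indices. *)
pose g i (m : multinom 3) : R := if (0 < m i)%N then mcoeff (mnm_sub m (mnm1 i)) (U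
  i) else 0.
(* At the constant monomial the inverse of 0 is harmless, as every [g i] vanishes there. *)
pose c m : R := (mdeg m)%:R^-1 * \sum_i g i m.
have c0 m : (k < mdeg m)%N -> c m = 0.
  move=> km; rewrite /c big1 ?mulr0// => i _; rewrite /g; case: ifPn => // mi.
  have := Uk i => /msize_leP; apply.
  have := mdegD (mnm_sub m (mnm1 i)) (mnm1 i); rewrite submK ?mdeg1 ?addn1.
    by move=> mE; rewrite -ltnS -mE.
  by apply/mnm_lepP => j; rewrite mnm1E; case: eqP => // <-.
pose p : poly3 := \sum_(m : bmultinom 3 k.+1) c m *: mpolyX R m.
have pE m : mcoeff m p = c m.
  rewrite raddf_sum /=; have [mk|km] := ltnP (mdeg m) k.+1; last first.
    rewrite c0// big1// => m' _; rewrite mcoeffZ mcoeffX; case: eqP => [m'E|];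
      last by rewrite mulr0.
    by have := bmdeg m'; rewrite m'E ltnNge km.
  rewrite (bigD1 (BMultinom mk)) //= big1 ?addr0 => [|m' m'm].
    by rewrite mcoeffZ mcoeffX eqxx mulr1.
  by rewrite mcoeffZ mcoeffX -[_ == m]/(m' == BMultinom mk) (negPf m'm) mulr0.
exists p; first by apply/msize_leP => m km; rewrite pE c0.
apply/ffunP => j; rewrite ffunE; apply/mpolyP => m.
rewrite mcoeff_mderiv pE /c mdegD mdeg1 addn1 -[LHS]mulr_natl.
(* Closedness of [U] on coefficients. Summing over [i] turns the factor on the right into
   [mdeg m + 1], which cancels the division in [c]. *)
have gE i : (m j).+1%:R * g i (mnm_add m (mnm1 j)) = (m i + (i == j))%:R * mcoeff m
  (U j).
  rewrite /g mnmDE mnm1E; have [->|ij] := eqVneq i j.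
    by rewrite addn1/= addmK.
  rewrite addn0; case: ifPn => [mi|]; last first.
    by rewrite -eqn0Ngt => /eqP ->; rewrite mulr0 mul0r.
  pose m' := mnm_sub m (mnm1 i).
  have mE : m = mnm_add m' (mnm1 i).
    by rewrite submK//; apply/mnm_lepP => l; rewrite mnm1E; case: eqP => // <-.
  have -> : mnm_sub (mnm_add m (mnm1 j)) (mnm1 i) = mnm_add m' (mnm1 j).
    by rewrite {1}mE -addmA (addmC (mnm1 i)) addmA addmK.
  have /(congr1 (mcoeff m')) := sym j i; rewrite !mcoeff_mderiv -mE.
  rewrite -[X in X = _ -> _]mulr_natl -[X in _ = X -> _]mulr_natl /m' !mnmBE !mnm1E
    eqxx (negPf ij) subn0 => ->.
  by rewrite subn1 prednK.
rewrite mulrCA mulr_sumr (eq_bigr _ (fun i _ => gE i)) -mulr_suml -natr_sum.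
rewrite big_split/= -mdegE (bigD1 j)//= eqxx big1 ?addn0 => [|i /negPf ->//].
by rewrite addn1 mulrA mulVf ?mul1r// pnatr_eq0.
Qed.

Lemma msize_mderiv k i p : (msize p <= k.+1)%N -> (msize (mderiv i p) <= k)%N.
Proof.
move/msize_leP => pk; apply/msize_leP => m km.
by rewrite mcoeff_mderiv pk ?mul0rn// mdegD mdeg1 addn1.
Qed.

Lemma PkP k (phi : 'rV[R]_3 -> R) :
  Pk k phi <-> exists2 p, (msize p <= k.+1)%N & phi = pev p.
Proof.
split=> [[p [pk phiE]]|[p pk ->]]; last by exists p.
by exists p => //; apply/funext.
Qed.

Lemma PkvP k (F : 'rV[R]_3 -> 'rV[R]_3) :
  Pkv k F <-> exists2 P : vpoly, (forall i, msize (P i) <= k.+1)%N & F = pvec P.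
Proof.
split=> [Fk|[P Pk ->] i]; last by rewrite coord_pvec; apply/PkP; exists (P i).
have /choice[P PE] : forall i, exists p : poly3, (msize p <= k.+1)%N /\ Defs.coord
  F i = pev p.
  by move=> i; have /PkP[p pk pE] := Fk i; exists p.
exists [ffun i => P i] => [i|]; first by rewrite ffunE; case: (PE i).
apply/funext => x; apply/rowP => i; rewrite mxE ffunE.
by have [_ <-] := PE i.
Qed.

End VectorPoly.

(** * Integration over simplices *)

Section Integrability.
Variable R : realType.
Local Notation poly3 := (mpoly 3 R).
Local Notation mu := (@lebesgue_measure R).
Local Notation leb2 := (@leb2 R).
Local Notation leb3 := (@leb3 R).
Local Notation reftri := (@Defs.reftri R).

Lemma measurable_pev d (X : measurableType d) (D : set X) (F : X -> 'rV[R]_3) (p :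
  poly3) :
  (forall i, measurable_fun D (fun x => F x 0 i)) ->
  measurable_fun D (fun x => pev p (F x)).
Proof.
move=> mF; elim/mpoly_ring_ind: p => [c|k|p q mp mq|p q mp mq].
- by under eq_fun do rewrite pevC; exact: measurable_cst.
- by under eq_fun do rewrite pevX; exact: mF.
- by under eq_fun do rewrite pevD; exact: measurable_funD.
- by under eq_fun do rewrite pevM; exact: measurable_funM.
Qed.

Lemma integrable_pev d (X : measurableType d) (nu : {measure set X -> \bar R})
    (D : set X) (F : X -> 'rV[R]_3) (B : R) (p : poly3) :
  measurable D -> (nu D < +oo)%E ->
  (forall i, measurable_fun D (fun x => F x 0 i)) ->
  (forall x i, D x -> `|F x 0 i| <= B) ->
  nu.-integrable D (EFin \o (fun x => pev p (F x))).
Proof.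
move=> mD Doo mF FB; apply: measurable_bounded_integrable => //.
  exact: measurable_pev.
have [C pC] := bounded_pev p B.
exists C; split; first exact: num_real.
by move=> M CM x Dx; apply: le_trans (ltW CM); apply: pC => i; exact: FB.
Qed.

Lemma measurable_gt0 d (X : measurableType d) (f : X -> R) :
  measurable_fun setT f -> measurable [set x | 0 < f x].
Proof.
move=> mf; rewrite (_ : [set _ | _] = setT `&` f @^-1` `]0, +oo[%classic).
  by apply: mf => //; exact: measurable_itv.
by rewrite setTI; apply/seteqP; split => x /=; rewrite in_itv/= andbT.
Qed.

Definition reftet : set (R * R * R) :=
  [set p | [/\ 0 < p.1.1, 0 < p.1.2, 0 < p.2 & p.1.1 + p.1.2 + p.2 < 1]].

Lemma measurable_reftri : measurable (reftri : set (measurableTypeR R *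
  measurableTypeR R)%type).
Proof.
have m1 : measurable_fun [set: R * R] fst by exact: measurable_fst.
have m2 : measurable_fun [set: R * R] snd by exact: measurable_snd.
rewrite (_ : reftri = [set q | 0 < q.1] `&` [set q | 0 < q.2] `&` [set q | 0 < 1 -
  (q.1 + q.2)]).
  apply: measurableI; first by apply: measurableI; exact: measurable_gt0.
  by apply: measurable_gt0; apply: measurable_funB => //; exact: measurable_funD.
by apply/seteqP; split=> [q []|q [[]]] /=; rewrite subr_gt0.
Qed.

Lemma measurable_reftet : measurable (reftet : set (measurableTypeR R *
  measurableTypeR R * measurableTypeR R)%type).
Proof.
have m1 := @measurable_pr1 R; have m2 := @measurable_pr2 R.
have m3 : measurable_fun [set: R * R * R] (fun p => p.2) by exact: measurable_snd.
rewrite (_ : reftet = [set q | 0 < q.1.1] `&` [set q | 0 < q.1.2] `&` [set q | 0 <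
  q.2] `&` [set q | 0 < 1 - (q.1.1 + q.1.2 + q.2)]).
  apply: measurableI.
    by apply: measurableI; [apply: measurableI|]; exact: measurable_gt0.
  apply: measurable_gt0; apply: measurable_funB => //.
  by apply: measurable_funD => //; exact: measurable_funD.
by apply/seteqP; split=> [q []|q [[[]]]] /=; rewrite subr_gt0.
Qed.

Lemma measurable_itv01 : measurable (`]0%R, 1%R[%classic : set (measurableTypeR R)).
Proof. exact (measurable_itv _). Qed.

Lemma reftri_lt_pinfty : (leb2 reftri < +oo)%E.
Proof.
apply: (@le_lt_trans _ _ (leb2 (`]0%R, 1%R[%classic `*` `]0%R, 1%R[%classic))).
  apply: le_measure; [by apply: mem_set; exact: measurable_reftri| |].
    by apply: mem_set; apply: measurableX; exact: measurable_itv01.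
  by move=> q [q1 q2 q3]; split; rewrite /= in_itv/= ?q1 ?q2/=; lra.
rewrite /Defs.leb2 product_measure1E;
  [|exact: measurable_itv01|exact: measurable_itv01].
change (mu `]0%R, 1%R[%classic * mu `]0%R, 1%R[%classic < +oo)%E.
by rewrite lebesgue_measure_itv/= lte_fin ltr01 oppr0 adde0 mule1 ltry.
Qed.

Lemma reftet_lt_pinfty : (leb3 reftet < +oo)%E.
Proof.
apply: (@le_lt_trans _ _ (leb3 (reftri `*` `]0%R, 1%R[%classic))).
  apply: le_measure; [by apply: mem_set; exact: measurable_reftet| |].
    by apply: mem_set; apply: measurableX;
      [exact: measurable_reftri|exact: measurable_itv01].
  by move=> q [q1 q2 q3 q4]; split; [split=> //; lra|rewrite /= in_itv/= q3/=; lra].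
rewrite /Defs.leb3 product_measure1E;
  [|exact: measurable_reftri|exact: measurable_itv01].
change (leb2 reftri * mu `]0%R, 1%R[%classic < +oo)%E.
rewrite lebesgue_measure_itv/= lte_fin ltr01 oppr0 adde0 mule1.
exact: reftri_lt_pinfty.
Qed.

(** The fibre of [reftet] over [q] is the interval from 0 to [1 - q.1 - q.2], on which the integral
    of a derivative is a difference of end values. *)
Lemma reftet_ftc (G g : R * R -> R -> R) :
  leb3.-integrable reftet (EFin \o (fun p => g p.1 p.2)) ->
  (forall q (z : R), is_derive z 1 (G q : R -> R) (g q z)) -> (forall q, continuous
    (g q)) ->
  \int[leb3]_(p in reftet) g p.1 p.2 =
  \int[leb2]_(q in reftri) (G q (1 - q.1 - q.2) - G q 0).
Proof.
move=> ig dG cg; rewrite Rintegral_mkcond [RHS]Rintegral_mkcond /Rintegral.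
congr fine.
pose f (p : R * R * R) := (((fun p => g p.1 p.2) \_ reftet) p)%:E.
have fi : leb3.-integrable setT f.
  have /(integrable_mkcond _ measurable_reftet) := ig.
  by apply: eq_integrable => // p _; rewrite /f /patch; case: ifP.
rewrite -(@integral12_prod_meas1 _ _ _ _ _ leb2 mu f fi).
apply: eq_integral => q _; rewrite /fubini_F /f /patch.
have [/set_mem[q1 q2 q3]|qN] := boolP (q \in reftri); last first.
  rewrite integral0_eq// => z _; case: ifPn => // /set_mem[/= z1 z2 z3 z4].
  by move: qN; rewrite notin_setE => -[]; split=> //; lra.
set b := 1 - q.1 - q.2; have b0 : 0 < b by rewrite /b; lra.
transitivity (\int[mu]_(z in `]0%R, b[%classic) (g q z)%:E)%E.
  rewrite [RHS]integral_mkcond; apply: eq_integral => z _; rewrite /patch.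
  suff -> : ((q, z) \in reftet) = (z \in `]0%R, b[%classic) by case: ifP.
  apply/idP/idP => /set_mem H; apply: mem_set.
    by case: H => /= h1 h2 h3 h4; rewrite in_itv/= h3 /b/=; lra.
  by move: H; rewrite /= in_itv/= /b => /andP[h1 h2]; split=> //=; lra.
have mg : measurable_fun setT (fun z => (g q z)%:E).
  by apply/measurable_EFinP; apply: continuous_measurable_fun; exact: cg.
(* The fibre is open, whereas the fundamental theorem is applied on the closed interval; the end
   points are null. *)
rewrite integral_itv_obnd_cbnd; last exact: measurable_funTS.
rewrite integral_itv_bndo_bndc; last exact: measurable_funTS.
rewrite (@continuous_FTC2 _ (g q) (G q)) ?EFinB//.
- exact/continuous_subspaceT/cg.
- have cG : continuous (G q).
    by move=> z; apply/differentiable_continuous/derivable1_diffP; have [] := dG q z.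
  split; first by move=> z _; have [] := dG q z.
    by apply: cvg_at_right_filter; exact: cG.
  by apply: cvg_at_left_filter; exact: cG.
- by move=> z _; rewrite derive1E; have [] := dG q z.
Qed.

End Integrability.

(** * Integrals of polynomials over a triangle in space *)

Section Triangle.
Variable R : realType.
Local Notation poly3 := (mpoly 3 R).
Local Notation leb2 := (@leb2 R).
Local Notation reftri := (@Defs.reftri R).
Implicit Types (A B C : 'rV[R]_3).

Definition tri_par A B C (q : R * R) : 'rV[R]_3 :=
  A + q.1 *: (B - A) + q.2 *: (C - A).

(** There is no area element: for the facets of a tetrahedron it will be the length of
    [face_normal]. *)
Definition tri (p : poly3) A B C : R :=
  \int[leb2]_(q in reftri) pev p (tri_par A B C q).

Lemma integrable_tri (p : poly3) A B C :
  leb2.-integrable reftri (EFin \o (fun q => pev p (tri_par A B C q))).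
Proof.
pose n (X : 'rV[R]_3) : R := \sum_i `|X 0 i|.
have nP (X : 'rV[R]_3) i : `|X 0 i| <= n X.
  by rewrite /n (bigD1 i)//= lerDl sumr_ge0.
apply: (@integrable_pev _ _ _ _ _ _ (n A + n (B - A) + n (C - A))).
- exact: measurable_reftri.
- exact: reftri_lt_pinfty.
- move=> i; apply: measurable_funTS; under eq_fun do rewrite !mxE.
  apply: measurable_funD; last by apply: measurable_funM => //; exact: measurable_snd.
  by apply: measurable_funD => //; apply: measurable_funM => //; exact: measurable_fst.
- move=> q i [q1 q2 q3].
  have -> : tri_par A B C q 0 i = A 0 i + q.1 * (B - A) 0 i + q.2 * (C - A) 0 i.
    by rewrite /tri_par !mxE.
  have le1 (t : R) (X : 'rV[R]_3) : 0 < t -> t < 1 -> `|t * X 0 i| <= n X.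
    move=> t0 t1; rewrite normrM gtr0_norm// (le_trans _ (nP X i))//.
    by rewrite ler_piMl// ltW.
  rewrite (le_trans (ler_normD _ _))// lerD//; last by apply: le1 => //; lra.
  by rewrite (le_trans (ler_normD _ _))// lerD//; apply: le1 => //; lra.
Qed.

(** The map (x, y) -> (1 - x - y, y) preserves [reftri] and its measure and exchanges the
    barycentric coordinates of [A] and [B]. Such symmetries reconcile the vertex order of a
    parametrization of the tetrahedron with that of its facets. *)
Lemma tri_swap01 (p : poly3) A B C : tri p A B C = tri p B A C.
Proof.
have N0 : (-1 : R) != 0 by rewrite oppr_eq0 oner_eq0.
have := Rintegral_scales (scales2_fst (-1) 1 N0) (@measurable_reftri R)
  (integrable_tri p A B C).
rewrite normrN1 invr1 mul1r => E; rewrite -[LHS]E /tri {E}.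
rewrite [X in \int[_]_(x in X) _](_ : _ = reftri).
  apply: eq_Rintegral => q _ /=; congr (pev p _).
  by apply/rowP => i; rewrite /tri_par !mxE /=; ring.
have flip (x y : R) : reftri (-1 * x + (-1 * y + 1), y) <-> reftri (x, y).
  by split=> -[/= h1 h2 h3]; split=> /=; lra.
by apply/seteqP; split=> -[x y] /=; have [] := flip x y.
Qed.

Lemma tri_swap02 (p : poly3) A B C : tri p A B C = tri p C B A.
Proof.
have N0 : (-1 : R) != 0 by rewrite oppr_eq0 oner_eq0.
have := Rintegral_scales (scales2_snd (-1) 1 N0) (@measurable_reftri R)
  (integrable_tri p A B C).
rewrite normrN1 invr1 mul1r => E; rewrite -[LHS]E /tri {E}.
rewrite [X in \int[_]_(x in X) _](_ : _ = reftri).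
  apply: eq_Rintegral => q _ /=; congr (pev p _).
  by apply/rowP => i; rewrite /tri_par !mxE /=; ring.
have flip (x y : R) : reftri (x, -1 * y + (-1 * x + 1)) <-> reftri (x, y).
  by split=> -[/= h1 h2 h3]; split=> /=; lra.
by apply/seteqP; split=> -[x y] /=; have [] := flip x y.
Qed.

Lemma tri_is_linear A B C : scalar (fun p : poly3 => tri p A B C).
Proof.
move=> a p q; rewrite /tri -(RintegralZl _ (@measurable_reftri R) (integrable_tri p
  A B C)).
rewrite -RintegralD; [|exact: measurable_reftri| |exact: integrable_tri].
  by apply: eq_Rintegral => x _; rewrite pevD pevZ.
rewrite (_ : _ \o _ = EFin \o (fun x => pev (a *: p) (tri_par A B C x))).
  exact: integrable_tri.
by apply/funext => x /=; rewrite pevZ.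
Qed.
End Triangle.

(** * Parametrizations of a nondegenerate tetrahedron *)

Section Tetrahedron.
Variables (R : realType) (T : 'I_4 -> 'rV[R]_3).
Local Notation poly3 := (mpoly 3 R).
Local Notation leb3 := (@leb3 R).
Hypothesis nT : Defs.nondegenerate T.

Definition edge (i : 'I_3) := T (lift ord0 i) - T ord0.
Let M : 'M[R]_3 := \matrix_i edge i.

Let uM : M \in unitmx.
Proof. by rewrite unitmxE unitfE. Qed.

Lemma mul_edge (u : 'rV[R]_3) : u *m M = \sum_k u 0 k *: edge k.
Proof. by rewrite mulmx_sum_row; apply: eq_bigr => k _; rewrite rowK. Qed.

(** The entries of [u] are the barycentric coordinates of the last three vertices; that of [T ord0]
    is the remainder to 1. *)
Lemma otetP (u : 'rV[R]_3) : otet T (u *m M + T ord0) <->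
  (forall k, 0 < u 0 k) /\ \sum_k u 0 k < 1.
Proof.
have bary (l : 'I_4 -> R) : \sum_i l i = 1 ->
    \sum_i l i *: T i = (\row_k l (lift ord0 k)) *m M + T ord0.
  rewrite big_ord_recl [\sum_i l i *: _]big_ord_recl /= => l1; rewrite mul_edge.
  rewrite -[in RHS](scale1r (T ord0)) -l1 scalerDl scaler_suml.
  rewrite addrCA; congr (_ + _); rewrite -big_split/=; apply: eq_bigr => k _.
  by rewrite mxE /edge scalerBr subrK.
split=> [[l [l0 _ l1]]|[u0 u1]].
  rewrite (bary l l1) => /addIr /(can_inj (mulmxK uM)) ->; split.
    by move=> k; rewrite mxE l0// in_setT.
  have := l1; rewrite big_ord_recl => <-.
  rewrite (eq_bigr (fun k => l (lift ord0 k))) => [|k _]; last by rewrite mxE.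
  by rewrite ltrDr l0// in_setT.
pose l (i : 'I_4) := if unlift ord0 i is Some k then u 0 k else 1 - \sum_k u 0 k.
have lS k : l (lift ord0 k) = u 0 k by rewrite /l liftK.
have l0 : l ord0 = 1 - \sum_k u 0 k by rewrite /l unlift_none.
have l1 : \sum_i l i = 1.
  by rewrite big_ord_recl l0 (eq_bigr _ (fun k _ => lS k)) subrK.
exists l; split=> //.
- by move=> i _; case: (unliftP ord0 i) => [k|] ->; rewrite ?lS// l0 subr_gt0.
- by move=> i; rewrite finset.in_setT.
- rewrite bary//; congr (_ *m _ + _); apply/rowP => k.
  by rewrite mxE lS.
Qed.

Definition vert (s : 'S_3) (i : 'I_3) := T (lift ord0 (s i)).

(** The permutation [s] lets any edge from [T ord0] be the direction of the last coordinate, the one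
    that [reftet_ftc] integrates. *)
Definition tet_par (s : 'S_3) (p : R * R * R) : 'rV[R]_3 :=
  T ord0 + p.1.1 *: (vert s 0 - T ord0) + p.1.2 *: (vert s 1 - T ord0)
  + p.2 *: (vert s 2%:R - T ord0).

Lemma tet_parE s p : tet_par s p = pt p *m row_perm s M + T ord0.
Proof.
rewrite mulmx_sum_row sum3E !pt0 !pt1 !pt2 /tet_par -!addrA addrC -!addrA.
by congr (_ *: _ + (_ *: _ + (_ *: _ + _))); apply/rowP => i; rewrite !mxE.
Qed.

Lemma otet_par s p : otet T (tet_par s p) <-> reftet p.
Proof.
rewrite tet_parE row_permE mulmxA otetP.
have uE k : (pt p *m perm_mx s) 0 k = pt p 0 (s^-1%g k).
  by rewrite -[s in LHS]invgK -col_permE mxE.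
rewrite (eq_bigr (fun k => pt p 0 (s^-1%g k))) => [|k _]; last exact: uE.
rewrite (reindex_inj (@perm_inj _ s)) (eq_bigr (fun k => pt p 0 k)) => [|k _];
  last first.
  by rewrite permK.
rewrite sum3E pt0 pt1 pt2; split=> [[h]|[h1 h2 h3 h4]]; last first.
  split=> // k; rewrite uE; elim/ord3P: (s^-1%g k); by rewrite ?pt0 ?pt1 ?pt2.
have h' k : 0 < pt p 0 k by rewrite -[k](permK s) -uE.
by split=> //; [rewrite -pt0|rewrite -pt1|rewrite -pt2].
Qed.

(** Permuting the rows changes the determinant only by a sign, so the factor does not depend on
    [s]. *)
Lemma scales_tet_par s : scales leb3 (fun p => unpt (tet_par s p)) `|\det M|^-1.
Proof.
have us : row_perm s M \in unitmx by rewrite row_permE unitmx_mul unitmx_perm.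
have := scales3_affine (T ord0) us.
rewrite row_permE det_mulmx det_perm normrM normrX normrN1 expr1n mul1r -row_permE.
by congr scales; apply/funext => p; rewrite tet_parE.
Qed.

End Tetrahedron.

(** * Polynomials on the reference tetrahedron *)

Section RefTet.
Variable R : realType.
Local Notation poly3 := (mpoly 3 R).
Local Notation mu := (@lebesgue_measure R).
Local Notation leb2 := (@leb2 R).
Local Notation leb3 := (@leb3 R).
Local Notation reftet := (@reftet R).

Lemma reftet_open (v : 'rV[R]_3) : reftet (unpt v) ->
  exists2 e : R, 0 < e & forall y, ball v e y -> reftet (unpt y).
Proof.
rewrite /unpt => -[/= v0 v1 v2 v3].
pose m := Num.min (Num.min (v 0 0) (v 0 1)) (Num.min (v 0 2%:R) (1 - (v 0 0 + v 0 1
  + v 0 2%:R))).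
have m0 : 0 < m by rewrite !lt_min v0 v1 v2 subr_gt0.
(* [m] is the least slack in the four inequalities; a third of it suffices because the sum of the
   three coordinates moves by less than three times the radius. *)
exists (m / 3%:R); first by rewrite divr_gt0.
move=> y vy.
have : m <= m by []. rewrite {2}/m !le_min => /andP[/andP[h0 h1] /andP[h2 h3]].
have b i : `|v 0 i - y 0 i| < m / 3%:R by case: vy => _; exact.
have := b 0; have := b 1; have := b 2%:R; rewrite !ltr_norml.
clear b vy; move: m0 h0 h1 h2 h3; move: m => m.
move: (v 0 0) (v 0 1) (v 0 2%:R) (y 0 0) (y 0 1) (y 0 2%:R) v0 v1 v2 v3 => a b c d e f.
move=> *; do 3?[match goal with H : is_true (_ && _) |- _ => move/andP : H => [? ?]
  end].
split=> /=; lra.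
Qed.

Lemma measurable_pt i : measurable_fun [set: R * R * R] (fun p => pt p 0 i).
Proof.
elim/ord3P: i.
- under eq_fun do rewrite pt0; exact: measurable_pr1.
- under eq_fun do rewrite pt1; exact: measurable_pr2.
- under eq_fun do rewrite pt2; exact: measurable_snd.
Qed.

Lemma integrable_reftet (p : poly3) :
  leb3.-integrable reftet (EFin \o (fun q => pev p (pt q))).
Proof.
apply: (@integrable_pev _ _ _ _ _ _ 1).
- exact: measurable_reftet.
- exact: reftet_lt_pinfty.
- by move=> i; apply: measurable_funTS; exact: measurable_pt.
- move=> q i [q1 q2 q3 q4]; elim/ord3P: i; rewrite ?pt0 ?pt1 ?pt2 gtr0_norm//; lra.
Qed.

(** Either [p] vanishes on the open set [reftet], hence everywhere, or it exceeds some [c / 2 > 0]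
    on a small cube, which keeps the integral away from 0. *)
Lemma pev_reftet_eq0 (p : poly3) : (forall x, 0 <= pev p x) ->
  \int[leb3]_(q in reftet) pev p (pt q) = 0 -> p = 0.
Proof.
move=> p0 ip; apply: pev_inj.
have [pv|] := pselect (forall v, reftet (unpt v) -> pev p v = 0).
  (* The centroid, as an interior point. *)
  pose v : 'rV[R]_3 := const_mx 4%:R^-1.
  have [e e0 vE] : exists2 e : R, 0 < e & forall y, ball v e y -> reftet (unpt y).
    by apply: reftet_open; split; rewrite /= !mxE; lra.
  apply: (@pev_locally0 _ _ v); apply/nbhs_ballP; exists e => // y vy.
  exact/pv/vE.
move=> /existsNP[v /not_implyP[vr pv]]; exfalso.
have {pv}c0 : 0 < pev p v by rewrite lt_neqAle p0 andbT eq_sym; apply/eqP.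
set c := pev p v in c0.
have [e1 e10 vE1] := reftet_open vr.
have [e2 /= e20 vE2] : exists2 e : R, 0 < e & forall y, ball v e y -> c / 2 < pev p y.
  have : \forall y \near v, c / 2 < pev p y.
    have := @continuous_pev R p v => /(_ [set r | c / 2 < r]); apply.
    by apply: lt_nbhsr; rewrite ltr_pdivrMr// ltr_pMr// ltr1n.
  by move=> /nbhs_ballP[e e0 h]; exists e => // y /h.
pose e := Num.min e1 e2; have e0 : 0 < e by rewrite lt_min e10.
(* Balls of the sup norm are cubes, so the volume is a product of three interval lengths. *)
pose I i := `]v 0 i - e, v 0 i + e[%classic : set (measurableTypeR R).
have mI i : measurable (I i) by exact: (measurable_itv `]v 0 i - e, v 0 i + e[).
pose Q : set (R * R * R) := I 0 `*` I 1 `*` I 2%:R.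
have mQ : measurable (Q : set (measurableTypeR R * measurableTypeR R *
  measurableTypeR R)%type).
  by apply: measurableX; [apply: measurableX|]; exact: mI.
have QE : leb3 Q = (2 * e * (2 * e) * (2 * e))%:E.
  have muI i : mu (I i) = (2 * e)%:E.
    rewrite /I lebesgue_measure_itv/= lte_fin ifT; last by lra.
    by rewrite -EFinB; congr (_%:E); lra.
  rewrite /Defs.leb3 product_measure1E//; last exact: measurableX.
  change (leb2 (I 0%R `*` I 1%R) * mu (I 2%:R%R) = (2 * e * (2 * e) * (2 * e))%:E)%E.
  rewrite /Defs.leb2 product_measure1E//.
  change (mu (I 0%R) * mu (I 1%R) * mu (I 2%:R%R) = (2 * e * (2 * e) * (2 * e))%:E)%E.
  by rewrite !muI -!EFinM.
have Qball q : Q q -> ball v e (pt q).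
  move=> [[q0 q1] q2]; split=> // i j; rewrite (ord1 i) {i}.
  rewrite /ball/=; elim/ord3P: j; rewrite ?pt0 ?pt1 ?pt2.
  - by move: q0; rewrite /I /= in_itv/= => /andP[? ?]; rewrite ltr_norml; lra.
  - by move: q1; rewrite /I /= in_itv/= => /andP[? ?]; rewrite ltr_norml; lra.
  - by move: q2; rewrite /I /= in_itv/= => /andP[? ?]; rewrite ltr_norml; lra.
have Qsub : Q `<=` reftet.
  move=> q /Qball vq; rewrite -[q]ptK; apply: vE1; apply: le_ball vq.
  by rewrite ge_min lexx.
have Qc q : Q q -> c / 2 <= pev p (pt q).
  move=> /Qball vq; apply/ltW/vE2; apply: le_ball vq.
  by rewrite ge_min lexx orbT.
have fi := integrable_reftet p; have mf := measurable_int _ fi.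
have : ((c / 2)%:E * leb3 Q <= \int[leb3]_(q in reftet) (pev p (pt q))%:E)%E.
  apply: (@le_trans _ _ (\int[leb3]_(q in Q) (pev p (pt q))%:E)%E).
    rewrite -integral_cst//; apply: ge0_le_integral => //.
    - by move=> q _; rewrite lee_fin; lra.
    - by apply: measurable_funS Qsub mf; exact: measurable_reftet.
  apply: ge0_subset_integral => //.
  - exact: measurable_reftet.
  - by move=> q _; rewrite lee_fin.
rewrite QE -EFinM -[X in (_ <= X)%E]fineK; last first.
  by apply: integrable_fin_num fi; exact: measurable_reftet.
rewrite lee_fin [X in _ <= X]ip leNgt => /negP; apply.
by rewrite !mulr_gt0// divr_gt0.
Qed.

Lemma pev_affine (p : poly3) (M : 'M[R]_3) (t : 'rV[R]_3) :
  exists q : poly3, forall v, pev p (v *m M + t) = pev q v.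
Proof.
elim/mpoly_ring_ind: p => [c|k|p1 p2 [q1 d1] [q2 d2]|p1 p2 [q1 d1] [q2 d2]].
- by exists (mpolyC 3 c) => v; rewrite !pevC.
- exists (\sum_i M i k *: mpolyX R (mnm1 i) + mpolyC 3 (t 0 k)) => v.
  rewrite pevX pevD pevC pev_sum !mxE; congr (_ + _); apply: eq_bigr => i _.
  by rewrite pevZ pevX mulrC.
- by exists (q1 + q2) => v; rewrite !pevD d1 d2.
- by exists (q1 * q2) => v; rewrite !pevM d1 d2.
Qed.

Lemma is_derive_pev_line (p : poly3) (x v : 'rV[R]_3) (z : R) :
  is_derive z 1 (fun z : R => pev p (x + z *: v) : R)
    (pev (\sum_i v 0 i *: mderiv i p) (x + z *: v)).
Proof.
have [d e] := is_derive_pev (x + z *: v) v p.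
have E : (fun h : R => h^-1 *: ((fun z : R => pev p (x + z *: v) : R) (h *: 1 + z)
  - pev p (x + z *: v))) =
    (fun h : R => h^-1 *: (pev p (h *: v + (x + z *: v)) - pev p (x + z *: v))).
  apply/funext => h; congr (_ *: (pev p _ - _)).
  transitivity (x + (h + z) *: v); last by rewrite scalerDl addrCA.
  by congr (_ + _ *: _); congr (_ + _); exact: mulr1.
apply: DeriveDef; first by rewrite /derivable /= E.
rewrite /derive /= E; rewrite [LHS]e pev_sum; apply: eq_bigr => i _.
by rewrite pevZ.
Qed.

End RefTet.

(** * Integrals of polynomials over a tetrahedron *)

Section TetIntegral.
Variables (R : realType) (T : 'I_4 -> 'rV[R]_3).
Local Notation poly3 := (mpoly 3 R).
Local Notation vpoly := {ffun 'I_3 -> poly3}.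
Local Notation leb2 := (@leb2 R).
Local Notation leb3 := (@leb3 R).
Local Notation reftet := (@reftet R).
Hypothesis nT : Defs.nondegenerate T.
Let M : 'M[R]_3 := \matrix_i edge T i.
Let uM : M \in unitmx. Proof. by rewrite unitmxE unitfE. Qed.

Definition tint (p : poly3) : R := vint (otet T) (pev p).

(** Inverse of [tet_par T 1]: it exhibits the open tetrahedron as a preimage of [reftet], whence its
    measurability and finite volume. *)
Let Tinv (q : R * R * R) : R * R * R := unpt (pt q *m invmx M - T ord0 *m invmx M).

Let TinvK q : tet_par T 1%g (Tinv q) = pt q.
Proof.
by rewrite tet_parE row_perm1 /Tinv unptK mulmxBl !mulmxKV// subrK.
Qed.

Let TinvE : @pt R @^-1` otet T = Tinv @^-1` reftet.
Proof.
by apply/seteqP; split=> q /=; rewrite -(TinvK q) => /(otet_par nT).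
Qed.

Let sTinv : scales leb3 Tinv `|\det (invmx M)|^-1.
Proof.
have := @scales3_affine R (invmx M) (- (T ord0 *m invmx M)).
by rewrite unitmx_inv => /(_ uM).
Qed.

Lemma measurable_otet : measurable (@pt R @^-1` otet T :
  set (measurableTypeR R * measurableTypeR R * measurableTypeR R)%type).
Proof.
have [mS _ _] := sTinv.
by rewrite TinvE -[X in measurable X]setTI; apply: mS => //; exact: measurable_reftet.
Qed.

Lemma otet_lt_pinfty : (leb3 (@pt R @^-1` otet T) < +oo)%E.
Proof.
have [_ c0 sE] := sTinv; rewrite TinvE sE; last exact: measurable_reftet.
by rewrite lte_mul_pinfty ?lee_fin//; exact: reftet_lt_pinfty.
Qed.

Lemma otet_bounded : exists B : R, forall x i, otet T x -> `|x 0 i| <= B.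
Proof.
exists (\sum_j \sum_i `|T j 0 i|) => x i [l [l0 _ l1 ->]].
rewrite summxE (le_trans (ler_norm_sum _ _ _))//; apply: ler_sum => j _.
rewrite mxE normrM (bigD1 i)//= ler_wpDr ?sumr_ge0//.
have lj0 : 0 < l j by apply: l0; rewrite finset.in_setT.
rewrite gtr0_norm// ler_piMl// -l1 (bigD1 j)//= lerDl sumr_ge0// => m _.
by apply/ltW/l0; rewrite finset.in_setT.
Qed.

Lemma integrable_otet (p : poly3) :
  leb3.-integrable (@pt R @^-1` otet T) (EFin \o (fun q => pev p (pt q))).
Proof.
have [B TB] := otet_bounded.
apply: (@integrable_pev _ _ _ _ _ _ B).
- exact: measurable_otet.
- exact: otet_lt_pinfty.
- by move=> i; apply: measurable_funTS; exact: measurable_pt.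
- by move=> q i /= /TB.
Qed.

Lemma tint_is_linear : scalar tint.
Proof.
move=> a p q; rewrite /tint /vint -(RintegralZl _ measurable_otet (integrable_otet p)).
rewrite -RintegralD; [|exact: measurable_otet| |exact: integrable_otet].
  by apply: eq_Rintegral => x _; rewrite pevD pevZ.
rewrite (_ : _ \o _ = EFin \o (fun x => pev (a *: p) (pt x))).
  exact: integrable_otet.
by apply/funext => x /=; rewrite pevZ.
Qed.

Lemma tint_par s (p : poly3) :
  \int[leb3]_(q in reftet) pev p (tet_par T s q) = `|\det M|^-1 * tint p.
Proof.
rewrite -(Rintegral_scales (scales_tet_par nT s) measurable_otet (integrable_otet p)).
rewrite [X in \int[_]_(x in X) _ = _](_ : _ = (fun q => unpt (tet_par T s q)) @^-1`
  (@pt R @^-1` otet T)).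
  by apply: eq_Rintegral => q _; rewrite unptK.
by apply/seteqP; split=> q /=; rewrite unptK; have [] := otet_par nT s q.
Qed.

(** Transported from the reference tetrahedron by an affine substitution; this makes the L2 product
    of polynomial fields on [T] definite. *)
Lemma tint_eq0 (p : poly3) : (forall x, 0 <= pev p x) -> tint p = 0 -> p = 0.
Proof.
move=> p0 ip.
have [q qE] := pev_affine p M (T ord0).
have q0 : q = 0.
  apply: pev_reftet_eq0 => [x|]; first by rewrite -qE.
  rewrite -[RHS](mulr0 `|\det M|^-1) -ip -(tint_par 1%g); apply: eq_Rintegral => x _.
  by rewrite tet_parE row_perm1 qE.
apply: pev_inj => x; have := qE ((x - T ord0) *m invmx M).
by rewrite q0 pev0 mulmxKV// subrK.
Qed.

(* Only the facets opposite to the two ends of an edge are transversal to it. *)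
Lemma tint_edge (s : 'S_3) (p : poly3) :
  tint (\sum_i (vert T s 2%:R - T ord0) 0 i *: mderiv i p) =
  `|\det M| * (tri p (vert T s 2%:R) (vert T s 0) (vert T s 1) -
               tri p (T ord0) (vert T s 0) (vert T s 1)).
Proof.
set q := \sum_i _; set e := vert T s 2%:R - T ord0.
have d0 : `|\det M| != 0 by rewrite normr_eq0 -unitfE -unitmxE.
apply: (mulfI (invr_neq0 d0)); rewrite mulrA mulVf// mul1r -(tint_par s).
pose x0 (h : R * R) := T ord0 + h.1 *: (vert T s 0 - T ord0) + h.2 *: (vert T s 1 -
  T ord0).
have [B TB] := otet_bounded.
pose G h (z : R) := pev p (x0 h + z *: e); pose g h (z : R) := pev q (x0 h + z *: e).
have ig : leb3.-integrable reftet (EFin \o (fun h => g h.1 h.2)).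
  change (leb3.-integrable reftet (EFin \o (fun h => pev q (tet_par T s h)))).
  apply: (@integrable_pev _ _ _ _ _ _ B).
  - exact: measurable_reftet.
  - exact: reftet_lt_pinfty.
  - move=> i; apply: measurable_funTS; rewrite /tet_par; under eq_fun do rewrite !mxE.
    have m1 := @measurable_pr1 R; have m2 := @measurable_pr2 R.
    have m3 : measurable_fun [set: R * R * R] (fun p => p.2) by exact: measurable_snd.
    apply: measurable_funD; last exact: measurable_funM.
    apply: measurable_funD; last exact: measurable_funM.
    by apply: measurable_funD => //; exact: measurable_funM.
  - by move=> h i rh; apply: TB; apply/(otet_par nT).
have dG h (z : R) : is_derive z 1 (G h : R -> R) (g h z) by exact: is_derive_pev_line.
have cg h : continuous (g h).
  move=> z; apply: (@continuous_comp _ _ _ (fun z : R => x0 h + z *: e));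
    last exact: continuous_pev.
  apply: cvgD; first exact: cvg_cst.
  exact: cvgZr_tmp cvg_id.
(* The upper end of a fibre lies on the facet opposite to [T ord0], the lower end on the facet
   opposite to [vert T s 2%:R]. *)
have GE1 h : G h (1 - h.1 - h.2) = pev p (tri_par (vert T s 2%:R) (vert T s 0)
  (vert T s 1) h).
  by congr (pev p _); apply/rowP => i; rewrite /x0 /e /tri_par !mxE; ring.
have GE0 h : G h 0 = pev p (tri_par (T ord0) (vert T s 0) (vert T s 1) h).
  by congr (pev p _); rewrite /x0 scale0r addr0.
rewrite [LHS](reftet_ftc ig dG cg) -RintegralB; [|exact: measurable_reftri
  |exact: integrable_tri|exact: integrable_tri].
by apply: eq_Rintegral => h _; rewrite GE1 GE0.
Qed.

End TetIntegral.

(** * Divergence theorem on a tetrahedron *)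

Section Vec3.
Variable R : realType.
Implicit Types u v w : 'rV[R]_3.

Lemma dotE u v : dot u v = u 0 0 * v 0 0 + u 0 1 * v 0 1 + u 0 2%:R * v 0 2%:R.
Proof. by rewrite /dot sum3E. Qed.

Lemma det3E u v w : dot (cross u v) w =
  (u 0 1 * v 0 2%:R - u 0 2%:R * v 0 1) * w 0 0 +
  (u 0 2%:R * v 0 0 - u 0 0 * v 0 2%:R) * w 0 1 +
  (u 0 0 * v 0 1 - u 0 1 * v 0 0) * w 0 2%:R.
Proof. by rewrite dotE !mxE !ord3D. Qed.

Lemma det_rows (E : 'I_3 -> 'rV[R]_3) :
  \det (\matrix_i E i) = dot (cross (E 0) (E 1)) (E 2%:R).
Proof.
have e11 : lift (0 : 'I_3) (0 : 'I_2) = 1 by exact: val_inj.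
have e12 : lift (0 : 'I_3) (1 : 'I_2) = 2%:R by exact: val_inj.
have e21 : lift (1 : 'I_3) (0 : 'I_2) = 0 by exact: val_inj.
have e22 : lift (1 : 'I_3) (1 : 'I_2) = 2%:R by exact: val_inj.
have e31 : lift (2%:R : 'I_3) (0 : 'I_2) = 0 by exact: val_inj.
have e32 : lift (2%:R : 'I_3) (1 : 'I_2) = 1 by exact: val_inj.
have det2 (A : 'M[R]_2) : \det A = A 0 0 * A 1 1 - A 0 1 * A 1 0.
  rewrite (expand_det_row _ 0) !big_ord_recl big_ord0 /cofactor !det_mx11 !mxE /=.
  have -> : lift 0 0 = 1 :> 'I_2 by exact: val_inj.
  have -> : lift 1 0 = 0 :> 'I_2 by exact: val_inj.
  by rewrite /= !addn0 expr0 expr1; ring.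
rewrite (expand_det_row _ 0) sum3E /cofactor !det2 !mxE e11 e12 e21 e22 e31 e32
  det3E /=.
ring.
Qed.
End Vec3.

Lemma tri_swap12 (R : realType) (p : mpoly 3 R) (A B C : 'rV[R]_3) :
  tri p A B C = tri p A C B.
Proof. by rewrite tri_swap01 tri_swap02 tri_swap01. Qed.

(** * Facet normals, fluxes and integration by parts for the curl *)

Section Faces.
Variables (R : realType) (T : 'I_4 -> 'rV[R]_3).
Local Notation poly3 := (mpoly 3 R).
Local Notation vpoly := {ffun 'I_3 -> poly3}.
Hypothesis nT : Defs.nondegenerate T.
Let M : 'M[R]_3 := \matrix_i edge T i.
Let uM : M \in unitmx. Proof. by rewrite unitmxE unitfE. Qed.
Local Notation E := (edge T).
Local Notation D := (dot (cross (E 0) (E 1)) (E 2%:R)).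

(* The outward normal of the facet opposite to the vertex [T j], with length
   twice the area of the facet. *)
Definition face_normal j : 'rV[R]_3 :=
  (- Num.sg (dot (fcross T j) (T j - fvtx T j 0))) *: fcross T j.

Definition face_tri j (p : poly3) : R := tri p (fvtx T j 0) (fvtx T j 1) (fvtx T j
  2%:R).

Lemma dotZl (a : R) (u v : 'rV[R]_3) : dot (a *: u) v = a * dot u v.
Proof. by rewrite !dotE !mxE; ring. Qed.

Lemma fvtx_lift :
  [/\ forall a, fvtx T (lift ord0 a) 0 = T ord0,
      fvtx T (lift ord0 0) 1 = T (lift ord0 1) /\ fvtx T (lift ord0 0) 2%:R = T
        (lift ord0 2%:R),
      fvtx T (lift ord0 1) 1 = T (lift ord0 0) /\ fvtx T (lift ord0 1) 2%:R = T
        (lift ord0 2%:R)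
    & fvtx T (lift ord0 2%:R) 1 = T (lift ord0 0) /\ fvtx T (lift ord0 2%:R) 2%:R =
      T (lift ord0 1)].
Proof.
split; first by elim/ord3P; congr (T _); exact: val_inj.
all: by split; congr (T _); exact: val_inj.
Qed.

(** The facet opposite to [T (lift ord0 a)] contains the two other edges from [T ord0]. The edge
    [E a] points inward, whence the sign, and spans with those two a parallelepiped of volume
    [|D|]. *)
Lemma face_normal_edge a b :
  dot (face_normal (lift ord0 a)) (E b) = - (`|D| *+ (a == b)).
Proof.
have sgN (x : R) : - Num.sg x * x = - `|x| by rewrite mulNr normrEsg.
rewrite /face_normal dotZl /fcross.
have [v0 [v01 v02] [v11 v12] [v21 v22]] := fvtx_lift.
elim/ord3P: a; rewrite !v0 ?v01 ?v02 ?v11 ?v12 ?v21 ?v22 -/(E _) -/(E _) -/(E _);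
  elim/ord3P: b; rewrite ?mulr1n ?mulr0n.
- rewrite sgN; congr (- `|_|); rewrite !det3E; ring.
- rewrite [X in _ * X](_ : _ = 0) ?mulr0 ?oppr0// det3E; ring.
- rewrite [X in _ * X](_ : _ = 0) ?mulr0 ?oppr0// det3E; ring.
- rewrite [X in _ * X](_ : _ = 0) ?mulr0 ?oppr0// det3E; ring.
- rewrite sgN -normrN; congr (- `|_|); rewrite !det3E; ring.
- rewrite [X in _ * X](_ : _ = 0) ?mulr0 ?oppr0// det3E; ring.
- rewrite [X in _ * X](_ : _ = 0) ?mulr0 ?oppr0// det3E; ring.
- rewrite [X in _ * X](_ : _ = 0) ?mulr0 ?oppr0// det3E; ring.
- by rewrite sgN.
Qed.

(** Two edges from [T ord0] differ by a vector parallel to the opposite facet, so all three have the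
    same product with its normal. *)
Lemma face_normal0_edge b : dot (face_normal ord0) (E b) = `|D|.
Proof.
rewrite /face_normal dotZl /fcross /fvtx.
have eE i j : T (lift ord0 i) - T (lift ord0 j) = E i - E j.
  by rewrite /edge opprB addrA subrK.
rewrite !eE [X in Num.sg X](_ : _ = - D); last first.
  by rewrite (_ : T ord0 - _ = - E 0) ?opprB// !det3E !mxE; ring.
rewrite [X in _ * X](_ : _ = D); last first.
  by elim/ord3P: b; rewrite !det3E !mxE; ring.
by rewrite sgrN opprK normrEsg.
Qed.

Lemma tint_edgeE a (p : poly3) :
  tint T (\sum_i (E a) 0 i *: mderiv i p) =
  `|D| * (face_tri ord0 p - face_tri (lift ord0 a) p).
Proof.
(* Exchanging [a] with the last index makes [E a] the edge along which [tint_edge] integrates. *)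
have EE : E a = vert T (tperm a 2%:R) 2%:R - T ord0 by rewrite /vert tpermR.
rewrite EE (tint_edge nT) det_rows {EE}.
have [v0 [v01 v02] [v11 v12] [v21 v22]] := fvtx_lift.
have t02 : tperm (0 : 'I_3) 2%:R 1 = 1 by rewrite tpermD.
have t12 : tperm (1 : 'I_3) 2%:R 0 = 0 by rewrite tpermD.
have -> : tri p (vert T (tperm a 2%:R) 2%:R) (vert T (tperm a 2%:R) 0) (vert T
  (tperm a 2%:R) 1) =
    face_tri ord0 p.
  rewrite /face_tri /fvtx /vert tpermR; elim/ord3P: a => /=.
  - by rewrite tpermL t02 tri_swap12.
  - by rewrite tpermL t12 tri_swap01.
  - by rewrite tperm1 !perm1 tri_swap01 tri_swap12.
suff -> : tri p (T ord0) (vert T (tperm a 2%:R) 0) (vert T (tperm a 2%:R) 1) =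
    face_tri (lift ord0 a) p by [].
rewrite /face_tri v0 /vert; elim/ord3P: a => /=.
- by rewrite tpermL t02 v01 v02 tri_swap12.
- by rewrite tpermL t12 v11 v12.
- by rewrite tperm1 !perm1 v21 v22.
Qed.

Lemma scalar_sum (V : lmodType R) (f : V -> R) (I : Type) (r : seq I)
    (c : I -> R) (e : I -> V) : scalar f ->
  f (\sum_(i <- r) c i *: e i) = \sum_(i <- r) c i * f (e i).
Proof.
move=> fl; pose g : {scalar V} := HB.pack f (GRing.isLinear.Build _ _ _ _ _ fl).
by rewrite -[f]/(g : V -> R) linear_sum; apply: eq_bigr => i _; rewrite linearZ.
Qed.

(** As [i] varies, both sides are vectors with the same products with the three edges: by
    [tint_edgeE] on the left, by the products of the normals with the edges on the right. The edges
    are the rows of the invertible [M]. *)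
Lemma tint_mderiv i (p : poly3) :
  tint T (mderiv i p) = \sum_j (face_normal j) 0 i * face_tri j p.
Proof.
pose a i := tint T (mderiv i p) - \sum_j (face_normal j) 0 i * face_tri j p.
suff : \col_i a i = 0 :> 'cV[R]_3.
  by move=> /matrixP/(_ i 0); rewrite !mxE => /eqP; rewrite subr_eq0 => /eqP.
rewrite -[LHS](mulKmx uM) (_ : M *m _ = 0) ?mulmx0//.
apply/colP => k; rewrite mxE [RHS]mxE.
have -> : \sum_j M k j * (\col_i a i) j 0 = \sum_i E k 0 i * a i.
  by apply: eq_bigr => j _; rewrite !mxE.
rewrite /a (eq_bigr (fun i => E k 0 i * tint T (mderiv i p) -
   \sum_j E k 0 i * ((face_normal j) 0 i * face_tri j p))); last first.
  by move=> m _; rewrite mulrBr mulr_sumr.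
rewrite sumrB -(scalar_sum _ _ _ (tint_is_linear nT)) tint_edgeE exchange_big/=.
rewrite (eq_bigr (fun j => dot (face_normal j) (E k) * face_tri j p)); last first.
  by move=> j _; rewrite /dot mulr_suml; apply: eq_bigr => m _; ring.
rewrite big_ord_recl face_normal0_edge.
rewrite (eq_bigr (fun b => - (`|D| *+ (b == k)) * face_tri (lift ord0 b) p));
  last first.
  by move=> b _; rewrite face_normal_edge.
have sumk (d F0 : R) (F : 'I_3 -> R) :
    d * F0 + \sum_b - (d *+ (b == k)) * F b = d * (F0 - F k).
  rewrite (bigD1 k)//= eqxx mulr1n big1 => [|b /negPf ->]; first by ring.
  by rewrite mulr0n oppr0 mul0r.
by rewrite sumk subrr.
Qed.

(** A zero cross product would be orthogonal to every edge, whereas some edge has product [|D|] or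
    [- |D|] with the normal. The length is a denominator in [normal]. *)
Lemma enorm_fcross_neq0 j : enorm (fcross T j) != 0.
Proof.
have D0 : `|D| != 0 by rewrite normr_eq0 -det_rows -unitfE -unitmxE.
suff : exists b, dot (face_normal j) (E b) != 0.
  move=> [b]; apply: contra; rewrite sqrtr_eq0 => h.
  have f0 : fcross T j = 0.
    have : dot (fcross T j) (fcross T j) = 0.
      by apply/eqP; rewrite eq_le h/= sumr_ge0// => i _; rewrite -expr2 sqr_ge0.
    move=> /eqP; rewrite psumr_eq0 => [/allP z|i _]; last by rewrite -expr2 sqr_ge0.
    apply/rowP => i; rewrite [RHS]mxE; have := z i (mem_index_enum i).
    by rewrite /= mulf_eq0 orbb => /eqP.
  by rewrite /face_normal f0 scaler0 dotE !mxE !mul0r !addr0.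
case: (unliftP ord0 j) => [a|] ->; last by exists 0; rewrite face_normal0_edge.
by exists a; rewrite face_normal_edge eqxx mulr1n oppr_eq0.
Qed.

(** The area element of [fint] cancels the normalization of [normal], which leaves [face_normal]. *)
Lemma fint_normal j (P : vpoly) :
  fint T j (fun x => dot (Defs.normal T j) (pvec P x)) =
  \sum_i (face_normal j) 0 i * face_tri j (P i).
Proof.
have e0 := enorm_fcross_neq0 j.
have -> : fint T j (fun x => dot (Defs.normal T j) (pvec P x)) =
    enorm (fcross T j) * face_tri j (\sum_i (Defs.normal T j) 0 i *: P i).
  congr (_ * _); apply: eq_Rintegral => q _.
  by rewrite pev_sum; apply: eq_bigr => i _; rewrite pevZ [pvec P _ _ _]mxE.
rewrite /face_tri (scalar_sum _ _ _ (@tri_is_linear R _ _ _)) mulr_sumr;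
  apply: eq_bigr => i _.
rewrite mulrA; congr (_ * _); rewrite /Defs.normal /face_normal !mxE mulrA;
  congr (_ * _).
by rewrite mulrCA mulfV// mulr1.
Qed.

Lemma triple (n u v : 'rV[R]_3) : dot (cross n u) v = dot n (cross u v).
Proof. by rewrite det3E dotE !mxE !ord3D; ring. Qed.

Lemma cross_pvec (P Q : vpoly) x : cross (pvec P x) (pvec Q x) = pvec (pcross P Q) x.
Proof. by apply/rowP => i; rewrite !mxE ffunE pevB !pevM. Qed.

Definition flux j (P : vpoly) := \sum_i (face_normal j) 0 i * face_tri j (P i).

Lemma flux_is_linear j : scalar (flux j).
Proof.
move=> a P Q; rewrite /flux mulr_sumr -big_split/=; apply: eq_bigr => i _.
by rewrite !ffunE /face_tri (@tri_is_linear R _ _ _ a) mulrDr mulrCA.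
Qed.

Lemma ipF_cross j (P Q : vpoly) :
  ipF T j (fun x => cross (Defs.normal T j) (pvec P x)) (pvec Q) = flux j (pcross P Q).
Proof.
rewrite /ipF /flux -fint_normal; congr (_ * _); apply: eq_Rintegral => q _.
by rewrite triple cross_pvec.
Qed.

(** The divergence theorem for P x Q, whose divergence is curl P . Q - P . curl Q. *)
Lemma stokes (P Q : vpoly) :
  tint T (pdot (pcurl P) Q) = tint T (pdot P (pcurl Q)) + \sum_j flux j (pcross P Q).
Proof.
have -> : \sum_j flux j (pcross P Q) = tint T (pdiv (pcross P Q)).
  have -> : pdiv (pcross P Q) = \sum_i 1 *: mderiv i (pcross P Q i).
    by apply: eq_bigr => i _; rewrite scale1r.
  rewrite (scalar_sum _ _ _ (tint_is_linear nT)) /flux exchange_big/=.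
  by apply: eq_bigr => i _; rewrite mul1r tint_mderiv.
rewrite pdiv_cross -[X in _ = X + _]mul1r -(tint_is_linear nT).
by rewrite scale1r addrC subrK.
Qed.

End Faces.

(** * Well-posedness of the postprocessing *)

Section Span.
Variable R : realType.
Local Notation poly3 := (mpoly 3 R).
Local Notation vpoly := {ffun 'I_3 -> poly3}.

(** One monomial in one component; [bmultinom 3 K] bounds the degree strictly by [K], in accordance
    with [msize]. *)
Definition vmonom K (mi : bmultinom 3 K * 'I_3) : vpoly :=
  [ffun i => if i == mi.2 then mpolyX R mi.1 else 0].

Lemma vmonom_span K (Z : vpoly) : (forall i, msize (Z i) <= K)%N ->
  Z = \sum_(mi : bmultinom 3 K * 'I_3) mcoeff mi.1 (Z mi.2) *: @vmonom K mi.
Proof.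
move=> ZK; apply/ffunP => i; rewrite sum_ffunE.
rewrite (eq_bigr (fun mi : bmultinom 3 K * 'I_3 =>
   if mi.2 == i then mcoeff mi.1 (Z i) *: mpolyX R mi.1 else 0)); last first.
  move=> mi _; rewrite !ffunE eq_sym; case: eqP => [->//|_]; exact: scaler0.
rewrite -(pair_bigA _ (fun (m : bmultinom 3 K) j =>
  if j == i then mcoeff m (Z i) *: mpolyX R m else 0))/=.
rewrite {1}(mpolywE (ZK i)); apply: eq_bigr => m _.
by rewrite -big_mkcond big_pred1_eq.
Qed.

Lemma msize_monoms (I : Type) (r : seq I) K (c : I -> R) (m : I -> bmultinom 3 K) :
  (msize (\sum_(i <- r) c i *: mpolyX R (m i)) <= K)%N.
Proof.
apply/msize_leP => m' Km; rewrite raddf_sum big1// => i _ /=.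
rewrite mcoeffZ mcoeffX; case: eqP => [mE|]; last by rewrite mulr0.
by move: Km; rewrite -mE leqNgt bmdeg.
Qed.

Lemma msize_vmonoms K (c : bmultinom 3 K * 'I_3 -> R) i :
  (msize ((\sum_(mi : bmultinom 3 K * 'I_3) c mi *: vmonom mi) i) <= K)%N.
Proof.
apply/msize_leP => m' Km; rewrite sum_ffunE raddf_sum big1// => mi _ /=.
rewrite !ffunE mcoeffZ; case: ifP => _; last by rewrite mcoeff0 mulr0.
rewrite mcoeffX; case: eqP => [mE|]; last by rewrite mulr0.
by move: Km; rewrite -mE leqNgt bmdeg.
Qed.
End Span.

Lemma scalarB (R : nzRingType) (V : lmodType R) (f : V -> R) (u v : V) :
  scalar f -> f (u - v) = f u - f v.
Proof. by move=> fl; rewrite addrC -scaleN1r fl mulN1r addrC. Qed.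

Section WellPosed.
Variables (R : realType) (T : 'I_4 -> 'rV[R]_3) (k : nat).
Local Notation poly3 := (mpoly 3 R).
Local Notation vpoly := {ffun 'I_3 -> poly3}.
Hypothesis nT : Defs.nondegenerate T.
Variables (uh uhat : 'rV[R]_3 -> 'rV[R]_3) (Uh : vpoly) (Uhat : 'I_4 -> vpoly).
Hypothesis uhE : forall x, otet T x -> uh x = pvec Uh x.
Hypothesis uhatE : forall j x, ofacet T j x -> uhat x = pvec (Uhat j) x.

(** Facet integrals run over the open reference triangle, hence only see the open facet, where
    [uhat] is polynomial. *)
Lemma ofacet_fpar j (q : R * R) : reftri q -> ofacet T j (fpar T j q).
Proof.
move=> [q1 q2 q3].
pose w (i : 'I_3) : R := [tuple 1 - q.1 - q.2; q.1; q.2]`_i.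
have w0 : w 0 = 1 - q.1 - q.2 by [].
have w1 : w 1 = q.1 by [].
have w2 : w 2%:R = q.2 by [].
pose l i := if unlift j i is Some k then w k else 0.
have lS i : l (lift j i) = w i by rewrite /l liftK.
have lj : l j = 0 by rewrite /l unlift_none.
exists l; split.
- move=> i; rewrite !finset.inE; case: (unliftP j i) => [i' -> _|->];
  last by rewrite eqxx.
  by rewrite lS; elim/ord3P: i'; rewrite ?w0 ?w1 ?w2; lra.
- by move=> i; rewrite !finset.inE negbK => /eqP ->.
- rewrite (bigD1_ord j)//= lj add0r (eq_bigr _ (fun i _ => lS i)) sum3E w0 w1 w2; ring.
- rewrite (bigD1_ord j)//= lj scale0r add0r.
  rewrite (eq_bigr (fun i => w i *: fvtx T j i)) => [|i _]; last by rewrite lS.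
  rewrite sum3E w0 w1 w2 /fpar; apply/rowP => i; rewrite !mxE; ring.
Qed.

Lemma ipT_pvec (U P : vpoly) :
  ipT T (fun x => pvec U x - uh x) (pvec P) = tint T (pdot (U - Uh) P).
Proof.
apply: eq_Rintegral => q /set_mem qT.
by rewrite uhE// -pvecB dot_pvec.
Qed.

Lemma ipF_pvec j (U P : vpoly) :
  ipF T j (fun x => cross (Defs.normal T j) (pvec U x) - cross (Defs.normal T j)
    (uhat x))
    (pvec P) = flux T j (pcross (U - Uhat j) P).
Proof.
rewrite -(ipF_cross nT); congr (_ * _); apply: eq_Rintegral => q /set_mem qT.
rewrite (uhatE (ofacet_fpar j qT)) pvecB; congr (dot _ _).
by apply/rowP => i; rewrite !mxE; ring.
Qed.

(** The fields [Uhat j] may differ from facet to facet, so [stokes] cannot turn the boundary sum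
    into a volume integral; [L] enters only as a linear functional. *)
Let L (P : vpoly) : R := tint T (pdot Uh (pcurl P)) + \sum_j flux T j (pcross (Uhat
  j) P).

Let L_is_linear : scalar L.
Proof.
move=> a P Q; rewrite /L !linearP (tint_is_linear nT) mulrDr mulr_sumr addrACA
  -big_split/=.
by congr (_ + _); apply: eq_bigr => j _; rewrite linearP (@flux_is_linear R T).
Qed.

Let ip (P Q : vpoly) : R := tint T (pdot P Q).

Let ip_linear P : scalar (ip P).
Proof. by move=> a Q1 Q2; rewrite /ip linearP (tint_is_linear nT). Qed.

Let ipC P Q : ip P Q = ip Q P. Proof. by rewrite /ip pdotC. Qed.

Let ip_linearl P : scalar (ip^~ P).
Proof. by move=> a Q1 Q2 /=; rewrite !(ipC _ P) ip_linear. Qed.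

Let ip_eq0 P : ip P P = 0 -> P = 0.
Proof.
move=> P0; have pE x : pev (pdot P P) x = \sum_i (pev (P i) x) ^+ 2.
  by rewrite pev_sum; apply: eq_bigr => i _; rewrite pevM.
have {}P0 : pdot P P = 0.
  by apply: (tint_eq0 nT) P0 => x; rewrite pE sumr_ge0// => i _; exact: sqr_ge0.
apply/ffunP => i; rewrite ffunE; apply: pev_inj => x.
have /eqP := pE x; rewrite P0 pev0 eq_sym psumr_eq0 => [/allP z|j _];
  last exact: sqr_ge0.
by have := z i (mem_index_enum i); rewrite /= sqrf_eq0 => /eqP.
Qed.

(** [msize] is the degree plus one: [k.+2] and [k.+3] stand for the degrees k+1 and k+2. *)
Lemma postprocessedP (U : vpoly) : (forall i, msize (U i) <= k.+2)%N ->
  postprocessed k T uh uhat (pvec U) <->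
  (forall Z : vpoly, (forall i, msize (Z i) <= k.+2)%N -> ip (pcurl U) (pcurl Z) =
    L (pcurl Z)) /\
  (forall v : poly3, (msize v <= k.+3)%N -> ip (U - Uh) (pgrad v) = 0).
Proof.
move=> Uk.
(* [stokes] merges the volume and boundary terms of [U] into its curl; the terms in [Uh] and [Uhat]
   make up [L]. *)
have e1 (P : vpoly) : ipT T (fun x => pvec U x - uh x) (pvec (pcurl P)) +
    \sum_j ipF T j (fun x => cross (Defs.normal T j) (pvec U x) - cross
      (Defs.normal T j) (uhat x)) (pvec P)
    = ip (pcurl U) P - L P.
  rewrite ipT_pvec (eq_bigr _ (fun j _ => ipF_pvec j U P)) /L /ip (stokes nT).
  have -> : tint T (pdot (U - Uh) (pcurl P)) = tint T (pdot U (pcurl P)) - tint T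
    (pdot Uh (pcurl P)).
    exact: (scalarB _ _ (ip_linearl _)).
  rewrite (eq_bigr (fun j => flux T j (pcross U P) - flux T j (pcross (Uhat j) P))).
    by rewrite sumrB; ring.
  move=> j _; rewrite -(scalarB _ _ (@flux_is_linear R T j)); congr (flux T j _).
  by apply/ffunP => i; rewrite !ffunE; ring.
split=> [[_ c1 c2]|[c1 c2]].
  split=> [Z Zk|v vk].
    apply/eqP; rewrite -subr_eq0 -e1 -curl_pvec; apply/eqP/c1.
    by exists (pvec Z); rewrite ?curl_pvec//; apply/PkvP; exists Z.
  by rewrite /ip -ipT_pvec -grad_pev; apply: c2; apply/PkP; exists v.
split; first by apply/PkvP; exists U.
  move=> _ [_ /PkvP[Z Zk ->] ->]; rewrite !curl_pvec e1.
  by apply/eqP; rewrite subr_eq0; apply/eqP/c1.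
by move=> _ /PkP[v vk ->]; rewrite grad_pev ipT_pvec; exact: c2.
Qed.

(** Spanning by the curls of monomial fields makes the representative appear directly as the curl of
    a field of degree at most k+1. *)
Let curl_solution : exists2 Z : vpoly, (forall i, msize (Z i) <= k.+2)%N &
  forall Z' : vpoly, (forall i, msize (Z' i) <= k.+2)%N -> ip (pcurl Z) (pcurl Z')
    = L (pcurl Z').
Proof.
have [c cE] := riesz_span (fun mi => pcurl (@vmonom R k.+2 mi)) ip_linearl
  ip_linear L_is_linear ip_eq0.
have curl_sum (d : bmultinom 3 k.+2 * 'I_3 -> R) :
    pcurl (\sum_mi d mi *: vmonom R mi) = \sum_mi d mi *: pcurl (vmonom R mi).
  by rewrite linear_sum; apply: eq_bigr => mi _; rewrite linearZ.
exists (\sum_mi c mi *: vmonom R mi) => [i|Z' Zk]; first exact: msize_vmonoms.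
rewrite (vmonom_span Zk) !curl_sum (scalar_sum _ _ _ (ip_linear _)) (scalar_sum _ _
  _ L_is_linear).
by apply: eq_bigr => mi _; rewrite cE.
Qed.

(** [pgrad v] is the L2-orthogonal projection of [P] onto the gradients. *)
Let grad_solution (P : vpoly) : exists2 v : poly3, (msize v <= k.+3)%N &
  forall v' : poly3, (msize v' <= k.+3)%N -> ip (pgrad v) (pgrad v') = ip P (pgrad v').
Proof.
have [c cE] := riesz_span (fun m : bmultinom 3 k.+3 => pgrad (mpolyX R m))
  ip_linearl ip_linear (ip_linear P) ip_eq0.
have grad_sum (d : bmultinom 3 k.+3 -> R) :
    pgrad (\sum_m d m *: mpolyX R m) = \sum_m d m *: pgrad (mpolyX R m).
  by rewrite linear_sum; apply: eq_bigr => mi _; rewrite linearZ.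
exists (\sum_m c m *: mpolyX R m) => [|v' vk]; first exact: msize_monoms.
rewrite (mpolywE vk) !grad_sum !(scalar_sum _ _ _ (ip_linear _)).
by apply: eq_bigr => mi _; rewrite cE.
Qed.

Let msizeD K (P Q : vpoly) : (forall i, msize (P i) <= K)%N -> (forall i, msize (Q
  i) <= K)%N ->
  forall i, (msize ((P + Q) i) <= K)%N.
Proof.
move=> PK QK i; apply/msize_leP => m Km; rewrite ffunE mcoeffD.
by have /msize_leP -> := PK i; rewrite // add0r; have /msize_leP -> := QK i.
Qed.

Theorem postprocessing_well_posed : exists! us, postprocessed k T uh uhat us.
Proof.
have [Z Zk ZE] := curl_solution; have [v vk vE] := grad_solution (Uh - Z).
(* Differentiation lowers the degree by one, so [pgrad v] has degree at most k+1. *)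
have Uk : forall i, (msize ((Z + pgrad v) i) <= k.+2)%N.
  by apply: msizeD => // i; rewrite ffunE; exact: msize_mderiv.
exists (pvec (Z + pgrad v)); split.
  apply/(postprocessedP Uk); split=> [Z' Z'k|v' v'k].
    by rewrite linearD/= pcurl_grad addr0 ZE.
  have -> : Z + pgrad v - Uh = pgrad v - (Uh - Z) by rewrite opprB addrCA addrA.
  by rewrite (scalarB _ _ (ip_linearl _)) vE// subrr.
move=> us' Hus'; have [/PkvP[U' U'k E] _ _] := Hus'; rewrite {}E in Hus' *.
have /(postprocessedP U'k)[c1 c2] := Hus'.
congr pvec; apply/esym/eqP; rewrite -subr_eq0; apply/eqP.
set U := Z + _ in Uk *.
have Wk : forall i, (msize ((U' - U) i) <= k.+2)%N.
  apply: msizeD => // i; apply/msize_leP => m km; rewrite ffunE mcoeffN.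
  by have /msize_leP -> := Uk i; rewrite ?oppr0.
have curlU : pcurl U = pcurl Z by rewrite linearD/= pcurl_grad addr0.
have curlW : pcurl (U' - U) = 0.
  apply: ip_eq0; rewrite linearB/= (scalarB _ _ (ip_linearl _)) -linearB/= c1//.
  by rewrite curlU ZE// subrr.
(* The potential has degree at most k+2, exactly the range of the test functions in the second
   family. *)
have [w wk wE] := poincare curlW Wk.
apply: ip_eq0; rewrite -{2}wE.
have -> : U' - U = (U' - Uh) - (U - Uh) by rewrite opprB addrA subrK.
rewrite (scalarB _ _ (ip_linearl _)) c2// sub0r; apply/eqP; rewrite oppr_eq0; apply/eqP.
have -> : U - Uh = pgrad v - (Uh - Z) by rewrite /U opprB addrCA addrA.
by rewrite (scalarB _ _ (ip_linearl _)) vE// subrr.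
Qed.

End WellPosed.

Theorem proposition5p1 (R : realType) (Omega : set 'rV[R]_3)
  (N : nat) (Th : 'I_N -> 'I_4 -> 'rV[R]_3) (k : nat)
  (eps : R) (beta : 'rV[R]_3 -> 'rV[R]_3) (gamma : 'rV[R]_3 -> R)
  (f g : 'rV[R]_3 -> 'rV[R]_3) (taut taun : 'I_N -> 'I_4 -> R)
  (wh uh uhat : 'rV[R]_3 -> 'rV[R]_3) :
  polyhedral_domain Omega ->
  triangulation Omega Th ->
  0 < eps ->
  W1oov Omega beta ->
  Lp +oo%E Omega gamma ->
  Lpv 2%:E Omega f ->
  H32 Omega Th g ->
  (forall K j, 0 <= taut K j) ->
  (forall K j, 0 <= taun K j) ->
  HDG_solution Omega Th k eps beta gamma f g taut taun wh uh uhat ->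
  forall K : 'I_N,
    exists! us : 'rV[R]_3 -> 'rV[R]_3, postprocessed k (Th K) uh uhat us.
Proof.
move=> _ [nd _ _ _] _ _ _ _ _ _ _ [[_ [_ Vuh] Muhat] _] K.
have [_ /PkvP[Uh _ ->] uhE] := Vuh K.
have /choice[Uhat uhatE] : forall j, exists Q : {ffun 'I_3 -> mpoly 3 R},
    forall x, ofacet (Th K) j x -> uhat x = pvec Q x.
  by move=> j; have [_ [_ /PkvP[Q _ ->] QE]] := Muhat K j; exists Q.
exact: (postprocessing_well_posed k (nd K) uhE uhatE).
Qed.
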